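(* Let $r\in\mathbb{Z}_{\ge 0}\cup\{\infty\}$ and let $\mathcal{A}^r=(\{f_i\}_{i=0}^{r-1},\{a_i\}_{i=0}^{r},u)$ be an approximation system for the sequence of holomorphic functions $\{g_i\}_{i=0}^r$ on $U$, with $g:=g_0$, where $f_i$ has domain $Y_i=U\times V_i$ and each $V_i$ is convex. Let $n<r+1$ be a nonnegative integer and assume that $\mathcal{A}^r$ is proper for order $n$, with $n$-th order approximation $g^{[n]}$. (A) For all $x\in U$, $$|g(x)-g^{[n]}(x)|\le \|D_2f_0\|_{Y_0}\cdots\|D_2f_{n-1}\|_{Y_{n-1}}\;\|g_n-g_n(u)\|_U\;\frac{d_U(u,x)^n}{n!}.$$ (B) If moreover $n<r$, then for all $x\in U$, $$|g(x)-g^{[n]}(x)|\le \|D_2f_0\|_{Y_0}\cdots\|D_2f_{n-1}\|_{Y_{n-1}}\;\|f_n\|_{U\times g_{n+1}(U)}\;\frac{d_U(u,x)^{n+1}}{(n+1)!}.$$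
   Context: An approximation system (AS) of order $r\in\mathbb{Z}_{\ge0}\cup\{\infty\}$ is a triple $\mathcal{A}^r=(\{f_i\}_{i=0}^{r-1},\{a_i\}_{i=0}^{r},u)$ consisting of: holomorphic functions $f_i\colon Y_i\to\mathbb{C}$ ($i<r$) of two complex variables, where $Y_i=U\times V_i\subset\mathbb{C}^2$, $U\subset\mathbb{C}$ is open, connected and simply connected (the domain of the AS), $V_i\subset\mathbb{C}$ is open, and $f_i(x,\cdot)$ is non-constant for every $x\in U$; complex constants $a_i$ ($i<r+1$) with $a_{i+1}\in V_i$ for $i<r$; and a base point $u\in U$. If $r=\infty$ the sequences are indexed by all $i\in\mathbb{Z}_{\ge0}$. $\mathcal{A}^r$ is an AS for the sequence $\{g_i\}_{i=0}^r$ if the $g_i$ are holomorphic functions on $U$ with $g_{i+1}(U)\subset V_i$ for $i<r$, $g_i(u)=a_i$ for $i<r+1$, and $g_i'(x)=f_i(x,g_{i+1}(x))$ for $x\in U$, $i<r$. For an integer $0\le n<r+1$ define recursively $g_n^{[n]}(x):=a_n$ and $g_i^{[n]}(x):=a_i+\int_u^x f_i(t,g_{i+1}^{[n]}(t))\,dt$ for $x\in U$, $i=n-1,\dots,0$. $\mathcal{A}^r$ is proper for order $n$ if at each step the inclusion $g_{i+1}^{[n]}(U)\subset V_i$ ($i<n$) holds, so that the construction makes sense; then $g^{[n]}:=g_0^{[n]}$ is the $n$-th order approximation. $D_2f$ is the derivative of $f$ with respect to its second argument; $\|f\|_Y$ is the sup norm of $f$ on $Y$ (possibly $+\infty$; if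 a norm on the right-hand side of an inequality is infinite, that inequality is regarded as trivially true). $d_U(v,w)$ is the infimum of the lengths of piecewise $C^1$ curves in $U$ connecting $v$ with $w$. Convention: $0^0=1$; empty products equal $1$. *)

(* Defs.v *)
From Stdlib Require Import Reals List Factorial.
From Coquelicot Require Import Coquelicot.
Open Scope R_scope.

(** * Holomorphy *)

Definition holomorphic_on (U : C -> Prop) (h : C -> C) : Prop :=
  forall x, U x -> ex_derive (K := C_AbsRing) (V := C_NormedModule) h x.

(** Two variables: Fréchet differentiability over the field [C] at every point
    of [Y], i.e. the differential is required to be complex linear. *)
Definition holomorphic2_on (Y : C * C -> Prop) (F : C * C -> C) : Prop :=
  forall p, Y p ->
    ex_filterdiff (K := C_AbsRing)
      (U := prod_NormedModule C_AbsRing C_NormedModule C_NormedModule)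
      (V := C_NormedModule) F (locally p).

Definition D2 (F : C * C -> C) (p : C * C) : C :=
  C_derive (fun y => F (fst p, y)) (snd p).

(** * Subsets of the complex plane *)

Definition setprod (A B : C -> Prop) (p : C * C) : Prop := A (fst p) /\ B (snd p).

Definition image (h : C -> C) (A : C -> Prop) (y : C) : Prop :=
  exists x, A x /\ y = h x.

Definition convex_set (A : C -> Prop) : Prop :=
  forall y z, A y -> A z ->
  forall t : R, 0 <= t <= 1 -> A (RtoC (1 - t) * y + RtoC t * z)%C.

Definition connected_set (U : C -> Prop) : Prop :=
  forall A B : C -> Prop, open A -> open B ->
    (forall x, U x -> A x \/ B x) ->
    (exists x, U x /\ A x) -> (exists x, U x /\ B x) ->
    exists x, U x /\ A x /\ B x.

Definition unit_interval (t : R) : Prop := 0 <= t <= 1.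

Definition unit_square (p : R * R) : Prop :=
  unit_interval (fst p) /\ unit_interval (snd p).

(** Every loop in [U] is homotopic in [U], with fixed base point, to a constant
    loop; connectedness is a separate requirement. *)
Definition simply_connected (U : C -> Prop) : Prop :=
  forall gamma : R -> C,
    continuous_on unit_interval gamma ->
    (forall t, unit_interval t -> U (gamma t)) ->
    gamma 0 = gamma 1 ->
    exists H : R * R -> C,
      continuous_on unit_square H /\
      (forall p, unit_square p -> U (H p)) /\
      (forall t, unit_interval t -> H (0, t) = gamma t) /\
      (forall t, unit_interval t -> H (1, t) = gamma 0) /\
      (forall s, unit_interval s -> H (s, 0) = gamma 0 /\ H (s, 1) = gamma 0).

(** * Curves *)

(** Derivatives are taken relative to the closed interval, hence are one-sided
    at its end points. *)
Definition C1_on (gamma : R -> C) (a b : R) : Prop :=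
  exists dgamma : R -> C,
    continuous_on (fun t => a <= t <= b) dgamma /\
    forall t, a <= t <= b ->
      filterdiff (K := R_AbsRing) (U := R_NormedModule) (V := C_R_NormedModule)
        gamma (within (fun s => a <= s <= b) (locally t))
        (fun h => scal h (dgamma t)).

Inductive piecewise_C1 (gamma : R -> C) : R -> R -> Prop :=
| piecewise_C1_piece a b :
    a < b -> C1_on gamma a b -> piecewise_C1 gamma a b
| piecewise_C1_concat a b c :
    piecewise_C1 gamma a b -> piecewise_C1 gamma b c -> piecewise_C1 gamma a c.

Definition curve_in (U : C -> Prop) (v w : C) (gamma : R -> C) : Prop :=
  piecewise_C1 gamma 0 1 /\
  (forall t, unit_interval t -> U (gamma t)) /\
  gamma 0 = v /\ gamma 1 = w.

(** [gamma'], with irrelevant values at the break points and at the end points,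
    which do not affect the integrals below. *)
Definition velocity (gamma : R -> C) (t : R) : C :=
  (Derive (fun s => Re (gamma s)) t, Derive (fun s => Im (gamma s)) t).

Definition curve_length (gamma : R -> C) : R :=
  RInt (fun t => Cmod (velocity gamma t)) 0 1.

Definition curve_int (h : C -> C) (gamma : R -> C) : C :=
  RInt (V := C_R_CompleteNormedModule)
    (fun t => (h (gamma t) * velocity gamma t)%C) 0 1.

(** [int_u^x h(t) dt] in [U]: the common value of the integrals of [h] along all
    piecewise C^1 curves in [U] from [u] to [x] (unspecified if there is none). *)
Definition path_int (U : C -> Prop) (h : C -> C) (u x : C) : C :=
  iota (T := C_R_CompleteNormedModule)
    (fun I : C => forall gamma, curve_in U u x gamma -> curve_int h gamma = I).

Definition inner_dist (U : C -> Prop) (v w : C) : R :=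
  real (Glb_Rbar (fun L => exists gamma, curve_in U v w gamma /\ L = curve_length gamma)).

(** * Sup norms *)

Definition supnorm {T : Type} (Y : T -> Prop) (F : T -> C) : Rbar :=
  Lub_Rbar (fun s => exists p, Y p /\ s = Cmod (F p)).

Definition prod_below (F : nat -> R) (n : nat) : R :=
  fold_right Rmult 1 (map F (seq 0 n)).

(** * Approximation systems *)

(** Orders are elements of [option nat], with [None] for infinity;
    [le_order i r] is [i < r + 1]. *)
Definition lt_order (i : nat) (r : option nat) : Prop :=
  match r with Some m => (i < m)%nat | None => True end.

Definition le_order (i : nat) (r : option nat) : Prop :=
  match r with Some m => (i <= m)%nat | None => True end.

(** The sequences are total on [nat]; only the entries with indices allowed by
    the order, and only the values of [as_f i] on [U * V_i], are constrained. *)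
Record approximation_system : Type := {
  as_order : option nat;
  as_U : C -> Prop;
  as_V : nat -> C -> Prop;
  as_f : nat -> C * C -> C;
  as_a : nat -> C;
  as_u : C;
  as_U_open : open as_U;
  as_U_connected : connected_set as_U;
  as_U_simply_connected : simply_connected as_U;
  as_V_open : forall i, lt_order i as_order -> open (as_V i);
  as_f_holomorphic : forall i, lt_order i as_order ->
    holomorphic2_on (setprod as_U (as_V i)) (as_f i);
  as_f_nonconstant : forall i, lt_order i as_order -> forall x, as_U x ->
    exists y z, as_V i y /\ as_V i z /\ as_f i (x, y) <> as_f i (x, z);
  as_a_in_V : forall i, lt_order i as_order -> as_V i (as_a (S i));
  as_u_in_U : as_U as_u
}.

Definition as_Y (A : approximation_system) (i : nat) : C * C -> Prop :=
  setprod (as_U A) (as_V A i).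

Definition is_AS_for (A : approximation_system) (g : nat -> C -> C) : Prop :=
  (forall i, le_order i (as_order A) -> holomorphic_on (as_U A) (g i)) /\
  (forall i, lt_order i (as_order A) ->
     forall x, as_U A x -> as_V A i (g (S i) x)) /\
  (forall i, le_order i (as_order A) -> g i (as_u A) = as_a A i) /\
  (forall i, lt_order i (as_order A) -> forall x, as_U A x ->
     is_derive (K := C_AbsRing) (V := C_NormedModule)
       (g i) x (as_f A i (x, g (S i) x))).

(** [approx_steps A k i] is [g_i^{[i + k]}]. *)
Fixpoint approx_steps (A : approximation_system) (k i : nat) : C -> C :=
  match k with
  | O => fun _ => as_a A i
  | S k' => fun x =>
      (as_a A i +
       path_int (as_U A) (fun t => as_f A i (t, approx_steps A k' (S i) t))
         (as_u A) x)%C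
  end.

Definition approx_stage (A : approximation_system) (n i : nat) : C -> C :=
  approx_steps A (n - i) i.

Definition proper_for_order (A : approximation_system) (n : nat) : Prop :=
  forall i, (i < n)%nat ->
  forall x, as_U A x -> as_V A i (approx_stage A n (S i) x).

Definition approx (A : approximation_system) (n : nat) : C -> C :=
  approx_stage A n 0.

(* Main.v *)
Require Import Defs.
From Stdlib Require Import Reals Factorial Lra Lia Psatz List ClassicalEpsilon.
From Coquelicot Require Import Coquelicot.
Open Scope R_scope.

(** Write [e_i] for [g_i] minus its approximation [g_i^{[n]}]. It vanishes at [u]
    and has derivative [f_i(x, g_{i+1}) - f_i(x, g_{i+1}^{[n]})], which is bounded by
    [||D_2 f_i|| |e_{i+1}|] since [V_i] is convex. Integrating along a curve from [u]
    parametrized by its arc length [l], a bound [|e_{i+1}| <= K l^k / k!] on the curve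
    becomes [|e_i| <= ||D_2 f_i|| K l^(k+1) / (k+1)!]. The descent from [n] to [0]
    starts from [|e_n| <= ||g_n - g_n(u)||] in (A) and from [|e_n| <= ||f_n|| l] in (B);
    at the end one takes the infimum over all curves.

    The integrals defining the approximations are primitives because of Cauchy's
    theorem: Goursat's bisection argument gives local primitives, and a homotopy
    contracting a loop carries a continuous choice of local primitives on the whole
    square, which is constant on the three sides where the homotopy is. *)

(** Holomorphy here is bare complex differentiability, so Cauchy's theorem has to start from
    Goursat's argument. The contracting homotopy is merely continuous, so nothing can be integrated
    along its intermediate curves; increments of local primitives still make sense there, and they
    agree with the integral on piecewise C^1 curves. A single compactness principle, bisection of a
    possibly degenerate rectangle, yields Goursat's theorem as well as existence and uniqueness of
    such primitives; a curve is treated as a rectangle of width zero.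

    The infimum defining d_U need not be attained, so the estimates avoid d_U until the very end:
    one curve is fixed, and every error is bounded at all of its parameters by the arc length
    travelled so far. Parts (A) and (B) are the same descent, with initial exponent [m = 0] and
    [m = 1]. *)

(* [is_derive] over [C_AbsRing] uses balls for [Cmod], while [open] and [continuous_on]
   on [C] use the coordinatewise uniform structure; explicit epsilons serve both. *)
Definition Cderiv (f : C -> C) (z l : C) : Prop :=
  forall eps : R, 0 < eps -> exists d : R, 0 < d /\
    forall w, Cmod (w - z) < d ->
      Cmod (f w - f z - (w - z) * l) <= eps * Cmod (w - z).

Definition Ccont (f : C -> C) (z : C) : Prop :=
  forall eps : R, 0 < eps -> exists d : R, 0 < d /\
    forall w, Cmod (w - z) < d -> Cmod (f w - f z) < eps.

(** [D] is a closed interval for the one-sided derivatives of [C1_on], and the whole line where a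
    theorem on integrals asks for two-sided ones. *)
Definition Rderiv (D : R -> Prop) (f : R -> C) (t : R) (l : C) : Prop :=
  forall eps : R, 0 < eps -> exists d : R, 0 < d /\
    forall s, D s -> Rabs (s - t) < d ->
      Cmod (f s - f t - RtoC (s - t) * l) <= eps * Rabs (s - t).

Definition Rcont (D : R -> Prop) (f : R -> C) (t : R) : Prop :=
  forall eps : R, 0 < eps -> exists d : R, 0 < d /\
    forall s, D s -> Rabs (s - t) < d -> Cmod (f s - f t) < eps.

Definition is_CInt (f : R -> C) (a b : R) (I : C) : Prop :=
  is_RInt (V := C_R_NormedModule) f a b I.

(** * Moduli, and the passage from filters to explicit epsilons *)

Lemma Cmod_sub_sym (z w : C) : Cmod (z - w) = Cmod (w - z).
Proof. rewrite <- Cmod_opp. f_equal. ring. Qed.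

Lemma Cmod_sub_triangle (x y z : C) : Cmod (x - z) <= Cmod (x - y) + Cmod (y - z).
Proof. replace (x - z)%C with ((x - y) + (y - z))%C by ring. apply Cmod_triangle. Qed.

Lemma Cmod_minus_le (x y : C) : Cmod (x - y) <= Cmod x + Cmod y.
Proof. unfold Cminus. rewrite <- (Cmod_opp y). apply Cmod_triangle. Qed.

Lemma Cmod_coord (x y : R) : Cmod (x, y) <= Rabs x + Rabs y.
Proof.
  replace (x, y) with (RtoC x + Ci * RtoC y)%C
    by (apply injective_projections; simpl; ring).
  eapply Rle_trans; [apply Cmod_triangle|].
  rewrite Cmod_mult, Cmod_Ci, !Cmod_R. lra.
Qed.

Lemma Rabs_fst_le (z : C) : Rabs (fst z) <= Cmod z.
Proof. eapply Rle_trans; [|apply Rmax_Cmod]. apply Rmax_l. Qed.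

Lemma Rabs_snd_le (z : C) : Rabs (snd z) <= Cmod z.
Proof. eapply Rle_trans; [|apply Rmax_Cmod]. apply Rmax_r. Qed.

(** Balls of the uniform structure are squares. The disc of radius [r] lies in the square of
    half-side [r], and the square of half-side [r / 2] lies in that disc. *)
Lemma locally_Cmod (P : C -> Prop) (z : C) :
  locally (T := C_UniformSpace) z P <->
  exists r : R, 0 < r /\ forall w, Cmod (w - z) < r -> P w.
Proof.
  split.
  - intros [r H]. exists r. split; [apply cond_pos|]. intros w Hw. apply H.
    split; eapply Rle_lt_trans; [apply (Rabs_fst_le (w - z)) | exact Hw
      | apply (Rabs_snd_le (w - z)) | exact Hw].
  - intros (r & Hr & H). assert (Hr2 : 0 < r / 2) by lra.
    exists (mkposreal _ Hr2). intros w [H1 H2]. apply H.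
    rewrite (surjective_pairing (w - z)%C). eapply Rle_lt_trans; [apply Cmod_coord|].
    change (Rabs (fst w - fst z) < r / 2) in H1.
    change (Rabs (snd w - snd z) < r / 2) in H2.
    change (Rabs (fst w - fst z) + Rabs (snd w - snd z) < r). lra.
Qed.

Lemma locally_R_iff (P : R -> Prop) (t : R) :
  locally t P <-> exists r : R, 0 < r /\ forall s, Rabs (s - t) < r -> P s.
Proof.
  split.
  - intros [r H]. exists r. split; [apply cond_pos|]. intros s Hs. now apply H.
  - intros (r & Hr & H). exists (mkposreal r Hr). intros s Hs. now apply H.
Qed.

Lemma is_derive_Cderiv (f : C -> C) (z l : C) :
  is_derive (K := C_AbsRing) (V := C_NormedModule) f z l <-> Cderiv f z l.
Proof.
  split.
  - intros [_ H] eps Heps.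
    destruct (H z (fun P HP => HP) (mkposreal eps Heps)) as [d Hd].
    exists d. split; [apply cond_pos|]. intros w Hw. exact (Hd w Hw).
  - intros H. split.
    { apply (is_linear_scal_l (K := C_AbsRing) (V := C_NormedModule)). }
    (* [filterdiff] quantifies over all limits of the filter; here [z] is the only one. *)
    intros x Hx. apply (is_filter_lim_locally_unique (V := AbsRing_NormedModule C_AbsRing)) in Hx.
    subst x. intros eps. destruct (H eps (cond_pos eps)) as (d & Hd & Hd').
    exists (mkposreal d Hd). intros w Hw. exact (Hd' w Hw).
Qed.

Lemma norm_R_remainder (f : R -> C) (l : C) (s t : R) :
  norm (K := R_AbsRing) (V := C_R_NormedModule)
    (minus (minus (f s) (f t)) (scal (minus s t) l))
  = Cmod (f s - f t - RtoC (s - t) * l).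
Proof.
  rewrite <- Cmod_norm. f_equal.
  apply injective_projections; simpl; unfold minus, plus, opp, scal; simpl;
    unfold mult; simpl; ring.
Qed.

Lemma filterdiff_Rderiv (f : R -> C) (a b t : R) (l : C) :
  a <= t <= b ->
  filterdiff (K := R_AbsRing) (U := R_NormedModule) (V := C_R_NormedModule)
    f (within (fun s => a <= s <= b) (locally t)) (fun h => scal h l)
  <-> Rderiv (fun s => a <= s <= b) f t l.
Proof.
  intros Ht.
  split.
  - intros [_ H] eps Heps.
    destruct (H t (fun P HP => filter_imp P _ (fun x p _ => p) HP) (mkposreal eps Heps)) as [d Hd].
    exists d. split; [apply cond_pos|]. intros s Hs Hst.
    rewrite <- norm_R_remainder. exact (Hd s Hst Hs).
  - intros H. split.
    { apply (is_linear_scal_l (K := R_AbsRing) (V := C_R_NormedModule)). }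
    intros x Hx.
    (* Since [t] belongs to the interval, it lies in every set of the restricted filter, hence in
       every ball around a limit [x] of it. *)
    assert (x = t).
    { apply (eq_close (K := R_AbsRing) (V := R_NormedModule)). intros e.
      destruct (Hx _ (locally_ball x e)) as [d Hd].
      exact (Hd t (ball_center t d) Ht). }
    subst x. intros eps. destruct (H eps (cond_pos eps)) as (d & Hd & Hd').
    exists (mkposreal d Hd). intros s Hs Hs'. generalize (Hd' s Hs' Hs). rewrite <- norm_R_remainder. exact (fun H => H).
Qed.

Lemma is_derive_Rderiv (f : R -> C) (t : R) (l : C) :
  is_derive (K := R_AbsRing) (V := C_R_NormedModule) f t l
  <-> Rderiv (fun _ => True) f t l.
Proof.
  split.
  - intros [_ H] eps Heps.
    destruct (H t (fun P HP => HP) (mkposreal eps Heps)) as [d Hd].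
    exists d. split; [apply cond_pos|]. intros s _ Hst.
    rewrite <- norm_R_remainder. exact (Hd s Hst).
  - intros H. split.
    { apply (is_linear_scal_l (K := R_AbsRing) (V := C_R_NormedModule)). }
    intros x Hx. apply (is_filter_lim_locally_unique (V := R_NormedModule)) in Hx.
    subst x. intros eps. destruct (H eps (cond_pos eps)) as (d & Hd & Hd').
    exists (mkposreal d Hd). intros s Hs. generalize (Hd' s I Hs).
    rewrite <- norm_R_remainder. exact (fun H => H).
Qed.

Lemma continuous_on_Rcont (D : R -> Prop) (f : R -> C) :
  continuous_on (T := R_UniformSpace) (U := C_UniformSpace) D f
  <-> (forall t, D t -> Rcont D f t).
Proof.
  split.
  - intros H t Ht eps Heps.
    destruct (proj1 (locally_R_iff _ t) (H t Ht _ (proj2 (locally_Cmod _ (f t))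
      (ex_intro _ eps (conj Heps (fun w Hw => Hw)))))) as (d & Hd & Hd').
    exists d. split; [exact Hd|]. intros s Hs Hst. exact (Hd' s Hst Hs).
  - intros H t Ht P HP. apply locally_Cmod in HP. destruct HP as (e & He & HP).
    destruct (H t Ht e He) as (d & Hd & Hd').
    apply (proj2 (locally_R_iff _ t)). exists d. split; [exact Hd|].
    intros s Hst Hs. apply HP. now apply Hd'.
Qed.

Lemma continuous_Rcont (f : R -> C) (t : R) :
  Rcont (fun _ => True) f t -> continuous (T := R_UniformSpace) (U := C_UniformSpace) f t.
Proof.
  intros H P HP. apply locally_Cmod in HP. destruct HP as (e & He & HP).
  destruct (H e He) as (d & Hd & Hd').
  apply (proj2 (locally_R_iff _ t)). exists d. split; [exact Hd|].
  intros s Hs. apply HP. now apply Hd'.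
Qed.

(** * Integrals of complex-valued functions of a real variable *)

Lemma is_CInt_derive (f df : R -> C) (a b : R) :
  (forall t, Rmin a b <= t <= Rmax a b -> Rderiv (fun _ => True) f t (df t)) ->
  (forall t, Rmin a b <= t <= Rmax a b -> Rcont (fun _ => True) df t) ->
  is_CInt df a b (f b - f a)%C.
Proof.
  intros Hf Hdf.
  apply (is_RInt_derive (V := C_R_CompleteNormedModule) f df).
  - intros t Ht. apply (proj2 (is_derive_Rderiv f t (df t))). auto.
  - intros t Ht. apply continuous_Rcont. auto.
Qed.

Lemma is_CInt_ex (f : R -> C) (a b : R) :
  (forall t, Rmin a b <= t <= Rmax a b -> Rcont (fun _ => True) f t) ->
  exists I, is_CInt f a b I.
Proof.
  intros H. apply (ex_RInt_continuous (V := C_R_CompleteNormedModule)).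
  intros t Ht. apply continuous_Rcont. auto.
Qed.

Lemma is_CInt_near_const (f : R -> C) (a b M : R) (v I : C) :
  (forall t, Rmin a b <= t <= Rmax a b -> Cmod (f t - v) <= M) ->
  is_CInt f a b I -> Cmod (I - RtoC (b - a) * v) <= Rabs (b - a) * M.
Proof.
  intros H HI. rewrite Cmod_norm.
  apply (norm_RInt_le_const_abs (V := C_R_NormedModule) (fun t => f t - v)%C).
  - intros t Ht. rewrite <- Cmod_norm. auto.
  - pose proof (is_RInt_minus (V := C_R_NormedModule) _ _ _ _ _ _ HI
      (is_RInt_const (V := C_R_NormedModule) a b v)) as H2.
    replace (I - RtoC (b - a) * v)%C with
      (minus (G := C_R_NormedModule) I (scal (V := C_R_NormedModule) (b - a) v)).
    + exact H2.
    + apply injective_projections; simpl; unfold minus, plus, opp, scal; simpl;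
        unfold mult; simpl; ring.
Qed.

(** * Bisection of rectangles *)

Lemma nested_intervals (a b : nat -> R) :
  (forall n, a n <= a (S n)) -> (forall n, b (S n) <= b n) -> (forall n, a n <= b n) ->
  exists x, forall n, a n <= x <= b n.
Proof.
  intros Ha Hb Hab.
  assert (Ha' : forall n k, a n <= a (n + k)%nat).
  { intros n k. induction k; [rewrite Nat.add_0_r; lra|].
    rewrite Nat.add_succ_r. specialize (Ha (n + k)%nat). lra. }
  assert (Hb' : forall n k, b (n + k)%nat <= b n).
  { intros n k. induction k; [rewrite Nat.add_0_r; lra|].
    rewrite Nat.add_succ_r. specialize (Hb (n + k)%nat). lra. }
  assert (Hub : forall n, is_upper_bound (fun y => exists m, y = a m) (b n)).
  { intros n y [m ->]. pose proof (Ha' m n). pose proof (Hb' n m).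
    rewrite (Nat.add_comm n m) in *. specialize (Hab (m + n)%nat). lra. }
  destruct (completeness (fun y => exists m, y = a m)) as [x [Hx1 Hx2]].
  - exists (b O). apply Hub.
  - exists (a O), O. reflexivity.
  - exists x. intros n. split; [apply Hx1; now exists n | apply Hx2, Hub].
Qed.

(** Excluded middle selects the first quarter on which [P] fails. The last quarter is returned
    untested: if the whole rectangle is bad and the other three quarters are good, it must be
    bad. *)
Definition bad_quarter (P : R -> R -> R -> R -> Prop) (q : (R * R) * (R * R)) : (R * R) * (R * R) :=
  let a := fst (fst q) in let b := snd (fst q) in
  let c := fst (snd q) in let d := snd (snd q) in
  let m := (a + b) / 2 in let k := (c + d) / 2 in
  if excluded_middle_informative (P a m c k) then
    if excluded_middle_informative (P m b c k) then
      if excluded_middle_informative (P a m k d) then ((m, b), (k, d))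
      else ((a, m), (k, d))
    else ((m, b), (c, k))
  else ((a, m), (c, k)).

(** Compactness of a rectangle in inductive form: a property inherited from the four quarters and
    true of all small rectangles around each point holds globally. A failure would descend to nested
    bad quarters shrinking to a point, where the local hypothesis contradicts it. Sides of length
    zero are allowed, so that intervals are covered too. *)
Lemma rect_bisection (P : R -> R -> R -> R -> Prop) (a b c d : R) :
  (forall a b c d, a <= b -> c <= d ->
    P a ((a + b) / 2) c ((c + d) / 2) -> P ((a + b) / 2) b c ((c + d) / 2) ->
    P a ((a + b) / 2) ((c + d) / 2) d -> P ((a + b) / 2) b ((c + d) / 2) d ->
    P a b c d) ->
  a <= b -> c <= d ->
  (forall x y, a <= x <= b -> c <= y <= d -> exists e, 0 < e /\
    forall a' b' c' d', a <= a' <= x -> x <= b' <= b -> c <= c' <= y -> y <= d' <= d ->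
      b' - a' < e -> d' - c' < e -> P a' b' c' d') ->
  P a b c d.
Proof.
  intros P_quarters Hab Hcd Hloc.
  destruct (excluded_middle_informative (P a b c d)) as [HP|HP]; [exact HP|exfalso].
  set (q := fun n => Nat.iter n (bad_quarter P) ((a, b), (c, d))).
  assert (Hq : forall n, let '((a1, b1), (c1, d1)) := q n in
      let '((a2, b2), (c2, d2)) := q (S n) in
      ~ P a1 b1 c1 d1 /\ a1 <= b1 /\ c1 <= d1 /\
      a1 <= a2 /\ b2 <= b1 /\ c1 <= c2 /\ d2 <= d1 /\
      b2 - a2 = (b1 - a1) / 2 /\ d2 - c2 = (d1 - c1) / 2).
  { assert (Hstep : forall q1,
      let '((a1, b1), (c1, d1)) := q1 in
      let '((a2, b2), (c2, d2)) := bad_quarter P q1 in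
      ~ P a1 b1 c1 d1 -> a1 <= b1 -> c1 <= d1 ->
      ~ P a2 b2 c2 d2 /\ a2 <= b2 /\ c2 <= d2 /\
      a1 <= a2 /\ b2 <= b1 /\ c1 <= c2 /\ d2 <= d1 /\
      b2 - a2 = (b1 - a1) / 2 /\ d2 - c2 = (d1 - c1) / 2).
    { intros [[a1 b1] [c1 d1]]. unfold bad_quarter; simpl.
      pose proof (P_quarters a1 b1 c1 d1) as H4.
      repeat destruct excluded_middle_informative; intros HnP H1 H2;
        (split; [tauto|]); lra. }
    induction n.
    - pose proof (Hstep (q O)) as H. change (q 1%nat) with (bad_quarter P (q O)).
      destruct (bad_quarter P (q O)) as [[a2 b2] [c2 d2]]. simpl in *. tauto.
    - pose proof (Hstep (q n)) as H. pose proof (Hstep (q (S n))) as H'.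
      change (q (S (S n))) with (bad_quarter P (q (S n))).
      change (q (S n)) with (bad_quarter P (q n)) in *.
      destruct (q n) as [[a1 b1] [c1 d1]].
      destruct (bad_quarter P ((a1, b1), (c1, d1))) as [[a2 b2] [c2 d2]].
      destruct (bad_quarter P ((a2, b2), (c2, d2))) as [[a3 b3] [c3 d3]].
      tauto. }
  assert (Hsize : forall n,
      snd (fst (q n)) - fst (fst (q n)) = (b - a) * (/ 2) ^ n /\
      snd (snd (q n)) - fst (snd (q n)) = (d - c) * (/ 2) ^ n).
  { induction n; [simpl; lra|]. specialize (Hq n).
    destruct (q n) as [[a1 b1] [c1 d1]]. destruct (q (S n)) as [[a2 b2] [c2 d2]].
    simpl in *. lra. }
  destruct (nested_intervals (fun n => fst (fst (q n))) (fun n => snd (fst (q n)))) as [x Hx].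
  1-3: intros n; specialize (Hq n); destruct (q n) as [[a1 b1] [c1 d1]];
    destruct (q (S n)) as [[a2 b2] [c2 d2]]; simpl; tauto.
  destruct (nested_intervals (fun n => fst (snd (q n))) (fun n => snd (snd (q n)))) as [y Hy].
  1-3: intros n; specialize (Hq n); destruct (q n) as [[a1 b1] [c1 d1]];
    destruct (q (S n)) as [[a2 b2] [c2 d2]]; simpl; tauto.
  assert (Hin : forall n, a <= fst (fst (q n)) /\ snd (fst (q n)) <= b /\
                          c <= fst (snd (q n)) /\ snd (snd (q n)) <= d).
  { induction n; [simpl; lra|]. specialize (Hq n).
    destruct (q n) as [[a1 b1] [c1 d1]]. destruct (q (S n)) as [[a2 b2] [c2 d2]].
    simpl in *. lra. }
  destruct (Hloc x y (Hx O) (Hy O)) as (e & He & Hloc').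
  (* This [n] brings both sides of the n-th rectangle below [e]. The summand 1 keeps the denominator
     positive for a degenerate rectangle. *)
  destruct (pow_lt_1_zero (/ 2) ltac:(rewrite Rabs_right; lra) (e / (b - a + (d - c) + 1))) as [n Hn].
  { apply Rdiv_lt_0_compat; lra. }
  specialize (Hn n (le_n n)). specialize (Hsize n). specialize (Hx n). specialize (Hy n).
  specialize (Hin n). specialize (Hq n).
  assert (Hp : 0 < (/ 2) ^ n) by (apply pow_lt; lra).
  rewrite Rabs_right in Hn by lra.
  apply Rmult_lt_compat_r with (r := b - a + (d - c) + 1) in Hn; [|lra].
  unfold Rdiv in Hn. rewrite Rmult_assoc, Rinv_l, Rmult_1_r in Hn by lra.
  destruct (q n) as [[a1 b1] [c1 d1]]. destruct (q (S n)) as [[a2 b2] [c2 d2]].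
  simpl in *. destruct Hq as [Hq _]. apply Hq, Hloc'; try lra; nra.
Qed.

(** * Goursat's theorem *)

Lemma Rderiv_lipschitz (D : R -> Prop) (f : R -> C) (t : R) (l : C) :
  Rderiv D f t l -> exists d : R, 0 < d /\ forall s, D s -> Rabs (s - t) < d ->
    Cmod (f s - f t) <= (Cmod l + 1) * Rabs (s - t).
Proof.
  intros H. destruct (H 1 Rlt_0_1) as (d & Hd & H').
  exists d. split; [exact Hd|]. intros s Hs Hst. specialize (H' s Hs Hst).
  replace (f s - f t)%C with ((f s - f t - RtoC (s - t) * l) + RtoC (s - t) * l)%C by ring.
  eapply Rle_trans; [apply Cmod_triangle|]. rewrite Cmod_mult, Cmod_R. lra.
Qed.

Lemma Rderiv_Rcont (D : R -> Prop) (f : R -> C) (t : R) (l : C) :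
  Rderiv D f t l -> Rcont D f t.
Proof.
  intros H eps Heps. destruct (Rderiv_lipschitz _ _ _ _ H) as (d & Hd & H').
  pose proof (Cmod_ge_0 l).
  assert (He : 0 < eps / (Cmod l + 1)) by (apply Rdiv_lt_0_compat; lra).
  exists (Rmin d (eps / (Cmod l + 1))). split; [now apply Rmin_glb_lt|].
  intros s Hs Hst. eapply Rle_lt_trans; [apply H'; [exact Hs|]|].
  - eapply Rlt_le_trans; [exact Hst | apply Rmin_l].
  - assert (Rabs (s - t) < eps / (Cmod l + 1))
      by (eapply Rlt_le_trans; [exact Hst | apply Rmin_r]).
    apply Rmult_lt_compat_l with (r := Cmod l + 1) in H1; [|lra].
    replace ((Cmod l + 1) * (eps / (Cmod l + 1))) with eps in H1 by (field; lra). exact H1.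
Qed.

Lemma Cderiv_comp_curve (F : C -> C) (D : R -> Prop) (f : R -> C) (t : R) (l v : C) :
  Cderiv F (f t) l -> Rderiv D f t v -> Rderiv D (fun s => F (f s)) t (l * v)%C.
Proof.
  intros HF Hf eps Heps.
  pose proof (Cmod_ge_0 l) as Hl. pose proof (Cmod_ge_0 v) as Hv.
  (* Half of [eps] goes to each error: the remainder of [F] is multiplied by the local Lipschitz
     constant [Cmod v + 1] of [f], the remainder of [f] by [Cmod l]. *)
  destruct (HF (eps / (2 * (Cmod v + 1)))) as (d1 & Hd1 & H1).
  { apply Rdiv_lt_0_compat; lra. }
  destruct (Hf (eps / (2 * (Cmod l + 1)))) as (d2 & Hd2 & H2).
  { apply Rdiv_lt_0_compat; lra. }
  destruct (Rderiv_lipschitz _ _ _ _ Hf) as (d3 & Hd3 & H3).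
  destruct (Rderiv_Rcont _ _ _ _ Hf d1 Hd1) as (d4 & Hd4 & H4).
  exists (Rmin (Rmin d2 d3) d4). split; [repeat apply Rmin_glb_lt; assumption|].
  intros s Hs Hst.
  pose proof (Rmin_l (Rmin d2 d3) d4). pose proof (Rmin_r (Rmin d2 d3) d4).
  pose proof (Rmin_l d2 d3). pose proof (Rmin_r d2 d3).
  specialize (H1 (f s) (H4 s Hs ltac:(lra))). specialize (H2 s Hs ltac:(lra)).
  specialize (H3 s Hs ltac:(lra)).
  replace (F (f s) - F (f t) - RtoC (s - t) * (l * v))%C
    with ((F (f s) - F (f t) - (f s - f t) * l) + l * (f s - f t - RtoC (s - t) * v))%C by ring.
  eapply Rle_trans; [apply Cmod_triangle|]. rewrite Cmod_mult.
  pose proof (Rabs_pos (s - t)) as Hst0.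
  replace (eps * Rabs (s - t)) with
    (eps / (2 * (Cmod v + 1)) * ((Cmod v + 1) * Rabs (s - t))
     + (Cmod l + 1) * (eps / (2 * (Cmod l + 1)) * Rabs (s - t))) by (field; lra).
  apply Rplus_le_compat.
  - eapply Rle_trans; [exact H1|]. apply Rmult_le_compat_l; [|exact H3].
    left. apply Rdiv_lt_0_compat; lra.
  - apply Rmult_le_compat; try lra; apply Cmod_ge_0.
Qed.

Lemma Cderiv_Ccont (f : C -> C) (z l : C) : Cderiv f z l -> Ccont f z.
Proof.
  intros H eps Heps. destruct (H 1 Rlt_0_1) as (d & Hd & H').
  pose proof (Cmod_ge_0 l).
  assert (He : 0 < eps / (Cmod l + 1)) by (apply Rdiv_lt_0_compat; lra).
  exists (Rmin d (eps / (Cmod l + 1))). split; [now apply Rmin_glb_lt|].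
  intros w Hw.
  assert (Hw1 : Cmod (w - z) < d) by (eapply Rlt_le_trans; [exact Hw | apply Rmin_l]).
  assert (Hw2 : Cmod (w - z) < eps / (Cmod l + 1))
    by (eapply Rlt_le_trans; [exact Hw | apply Rmin_r]).
  specialize (H' w Hw1).
  replace (f w - f z)%C with ((f w - f z - (w - z) * l) + (w - z) * l)%C by ring.
  eapply Rle_lt_trans; [apply Cmod_triangle|]. rewrite Cmod_mult.
  apply Rmult_lt_compat_l with (r := Cmod l + 1) in Hw2; [|lra].
  replace ((Cmod l + 1) * (eps / (Cmod l + 1))) with eps in Hw2 by (field; lra). lra.
Qed.

Lemma Ccont_comp_curve (F : C -> C) (D : R -> Prop) (f : R -> C) (t : R) :
  Ccont F (f t) -> Rcont D f t -> Rcont D (fun s => F (f s)) t.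
Proof.
  intros HF Hf eps Heps. destruct (HF eps Heps) as (d & Hd & H).
  destruct (Hf d Hd) as (d' & Hd' & H'). exists d'. split; [exact Hd'|].
  intros s Hs Hst. apply H. now apply H'.
Qed.

Lemma Rderiv_affine (D : R -> Prop) (f : R -> C) (t : R) (v : C) :
  (forall s, D s -> f s - f t = RtoC (s - t) * v)%C -> Rderiv D f t v.
Proof.
  intros H eps Heps. exists 1. split; [lra|]. intros s Hs _.
  rewrite H by exact Hs. replace (_ - _)%C with (RtoC 0) by ring. rewrite Cmod_0.
  apply Rmult_le_pos; [lra | apply Rabs_pos].
Qed.

Lemma Rderiv_horizontal (D : R -> Prop) (y t : R) : Rderiv D (fun s => (s, y)) t (RtoC 1).
Proof. apply Rderiv_affine. intros s _. apply injective_projections; simpl; ring. Qed.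

Lemma Rderiv_vertical (D : R -> Prop) (x t : R) : Rderiv D (fun s => (x, s)) t Ci.
Proof. apply Rderiv_affine. intros s _. apply injective_projections; simpl; ring. Qed.

(** The remainder is exactly [q * (w - z)^2]. This polynomial is the global primitive of an affine
    function on which Goursat's local estimate rests. *)
Lemma Cderiv_quadratic (p q z0 z : C) :
  Cderiv (fun w => p * w + q * ((w - z0) * (w - z0)))%C z (p + 2 * q * (z - z0))%C.
Proof.
  intros eps Heps. pose proof (Cmod_ge_0 q) as Hq.
  exists (eps / (Cmod q + 1)). split; [apply Rdiv_lt_0_compat; lra|].
  intros w Hw. pose proof (Cmod_ge_0 (w - z)) as Hp.
  replace (_ - _)%C with (q * (w - z) * (w - z))%C by ring.
  rewrite !Cmod_mult. apply Rmult_le_compat_r; [exact Hp|].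
  apply Rmult_lt_compat_l with (r := Cmod q + 1) in Hw; [|lra].
  replace ((Cmod q + 1) * (eps / (Cmod q + 1))) with eps in Hw by (field; lra). nra.
Qed.

Lemma Rcont_const_mul (D : R -> Prop) (f : R -> C) (t : R) (c : C) :
  Rcont D f t -> Rcont D (fun s => c * f s)%C t.
Proof.
  intros H. apply (Ccont_comp_curve (fun w => c * w)%C); [|exact H].
  apply Cderiv_Ccont with c. intros eps Heps. exists 1. split; [lra|]. intros w _.
  replace (_ - _)%C with (RtoC 0) by ring. rewrite Cmod_0.
  apply Rmult_le_pos; [lra | apply Cmod_ge_0].
Qed.

(** The integral lives in a real module, so a complex factor cannot simply be pulled out;
    multiplication by [Ci] is checked on coordinates, where it maps (Re, Im) to (- Im, Re). *)
Lemma is_CInt_Ci (f : R -> C) (a b : R) (I : C) :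
  is_CInt f a b I -> is_CInt (fun t => Ci * f t)%C a b (Ci * I)%C.
Proof.
  intros H.
  pose proof (is_RInt_fct_extend_fst (U := R_NormedModule) (V := R_NormedModule) f a b I H) as H1.
  pose proof (is_RInt_fct_extend_snd (U := R_NormedModule) (V := R_NormedModule) f a b I H) as H2.
  apply (is_RInt_fct_extend_pair (U := R_NormedModule) (V := R_NormedModule)).
  - change (is_RInt (V := R_NormedModule) (fun t => fst (Ci * f t)%C) a b (fst (Ci * I)%C)).
    replace (fst (Ci * I)%C) with (opp (snd I)) by (unfold opp; simpl; ring).
    apply (is_RInt_ext (fun t => opp (snd (f t)))).
    { intros t _. unfold opp; simpl. ring. }
    exact (is_RInt_opp (V := R_NormedModule) _ _ _ _ H2).
  - change (is_RInt (V := R_NormedModule) (fun t => snd (Ci * f t)%C) a b (snd (Ci * I)%C)).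
    replace (snd (Ci * I)%C) with (fst I) by (simpl; ring).
    apply (is_RInt_ext (fun t => fst (f t))).
    { intros t _. simpl. ring. }
    exact H1.
Qed.

Definition CInt (f : R -> C) (a b : R) : C := RInt (V := C_R_CompleteNormedModule) f a b.

Lemma is_CInt_CInt (f : R -> C) (a b : R) (I : C) : is_CInt f a b I -> CInt f a b = I.
Proof. exact (is_RInt_unique (V := C_R_CompleteNormedModule) f a b I). Qed.

Lemma CInt_correct (f : R -> C) (a b : R) :
  (forall t, Rmin a b <= t <= Rmax a b -> Rcont (fun _ => True) f t) ->
  is_CInt f a b (CInt f a b).
Proof.
  intros H. destruct (is_CInt_ex f a b H) as [I HI]. now rewrite (is_CInt_CInt _ _ _ _ HI).
Qed.

(** The surrounding interval from [p] to [q] allows [a], [b], [c] in any order, as needed for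
    increments of either sign. *)
Lemma CInt_chasles (f : R -> C) (p q a b c : R) :
  p <= a <= q -> p <= b <= q -> p <= c <= q ->
  (forall t, p <= t <= q -> Rcont (fun _ => True) f t) ->
  (CInt f a c = CInt f a b + CInt f b c)%C.
Proof.
  intros Ha Hb Hc H. apply is_CInt_CInt.
  apply (is_RInt_Chasles (V := C_R_NormedModule) f a b c); apply CInt_correct;
    intros t Ht; apply H; revert Ht; unfold Rmin, Rmax; destruct Rle_dec; lra.
Qed.

Lemma CInt_swap (f : R -> C) (p q a b : R) :
  p <= a <= q -> p <= b <= q ->
  (forall t, p <= t <= q -> Rcont (fun _ => True) f t) ->
  (CInt f b a = - CInt f a b)%C.
Proof.
  intros Ha Hb H. apply is_CInt_CInt.
  apply (is_RInt_swap (V := C_R_NormedModule)). apply CInt_correct.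
  intros t Ht; apply H; revert Ht; unfold Rmin, Rmax; destruct Rle_dec; lra.
Qed.

Lemma is_CInt_close (f g : R -> C) (a b M : R) (I J : C) :
  (forall t, Rmin a b <= t <= Rmax a b -> Cmod (f t - g t) <= M) ->
  is_CInt f a b I -> is_CInt g a b J -> Cmod (I - J) <= Rabs (b - a) * M.
Proof.
  intros H HI HJ.
  replace (I - J)%C with (I - J - RtoC (b - a) * 0)%C by ring.
  apply (is_CInt_near_const (fun t => f t - g t)%C).
  - intros t Ht. replace (_ - 0)%C with (f t - g t)%C by ring. auto.
  - exact (is_RInt_minus (V := C_R_NormedModule) _ _ _ _ _ _ HI HJ).
Qed.

(** The contour integral of h dz counterclockwise around the rectangle; the factor [Ci] is dz/dt on
    the vertical sides. *)
Definition boundary_int (h : C -> C) (a b c d : R) : C :=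
  (CInt (fun s => h (s, c)) a b + Ci * CInt (fun t => h (b, t)) c d
   - CInt (fun s => h (s, d)) a b - Ci * CInt (fun t => h (a, t)) c d)%C.

Definition diff_on_rect (h : C -> C) (a b c d : R) : Prop :=
  forall x y, a <= x <= b -> c <= y <= d -> exists l, Cderiv h (x, y) l.

Lemma Cderiv_Rcont_horizontal (h : C -> C) (x y : R) (l : C) :
  Cderiv h (x, y) l -> Rcont (fun _ => True) (fun s => h (s, y)) x.
Proof.
  intros H. apply (Ccont_comp_curve h _ (fun s => (s, y))).
  - now apply Cderiv_Ccont with l.
  - apply (Rderiv_Rcont _ _ _ 1), Rderiv_horizontal.
Qed.

Lemma Cderiv_Rcont_vertical (h : C -> C) (x y : R) (l : C) :
  Cderiv h (x, y) l -> Rcont (fun _ => True) (fun s => h (x, s)) y.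
Proof.
  intros H. apply (Ccont_comp_curve h _ (fun s => (x, s))).
  - now apply Cderiv_Ccont with l.
  - apply (Rderiv_Rcont _ _ _ Ci), Rderiv_vertical.
Qed.

(** The outer sides split at [m] and [k]; each inner edge is run through twice in opposite
    directions and cancels. *)
Lemma boundary_int_quarters (h : C -> C) (a m b c k d : R) :
  a <= m <= b -> c <= k <= d -> diff_on_rect h a b c d ->
  boundary_int h a b c d =
  (boundary_int h a m c k + boundary_int h m b c k
   + boundary_int h a m k d + boundary_int h m b k d)%C.
Proof.
  intros Hm Hk H. unfold boundary_int.
  assert (HH : forall y, c <= y <= d -> (CInt (fun s => h (s, y)) a b =
    CInt (fun s => h (s, y)) a m + CInt (fun s => h (s, y)) m b)%C).
  { intros y Hy. apply (CInt_chasles _ a b); [lra..|]. intros t Ht.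
    destruct (H t y Ht Hy) as [l Hl]. now apply Cderiv_Rcont_horizontal with l. }
  assert (HV : forall x, a <= x <= b -> (CInt (fun s => h (x, s)) c d =
    CInt (fun s => h (x, s)) c k + CInt (fun s => h (x, s)) k d)%C).
  { intros x Hx. apply (CInt_chasles _ c d); [lra..|]. intros t Ht.
    destruct (H x t Hx Ht) as [l Hl]. now apply Cderiv_Rcont_vertical with l. }
  rewrite (HH c), (HH d), (HV a), (HV b) by lra. ring.
Qed.

(* Up to [e] times the diameter, [h] is affine near [(x, y)], and affine functions
   have global primitives. *)
Lemma boundary_int_local (h : C -> C) (x y e : R) (l : C) :
  Cderiv h (x, y) l -> 0 < e -> exists r, 0 < r /\
  forall a b c d, a <= x <= b -> c <= y <= d -> b - a < r -> d - c < r ->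
    diff_on_rect h a b c d ->
    Cmod (boundary_int h a b c d) <= e * (b - a + (d - c)) ^ 2.
Proof.
  intros Hl He. destruct (Hl (e / 2) ltac:(lra)) as (r & Hr & H).
  exists (r / 2). split; [lra|]. intros a b c d Hx Hy Hab Hcd Hdiff.
  set (z := (x, y) : C) in *.
  (* The slope is written [2 * (l / 2)] so that [aff] is literally the derivative of [A] supplied by
     [Cderiv_quadratic]. *)
  set (aff := fun w => (h z + 2 * (l / 2) * (w - z))%C).
  set (A := fun w => (h z * w + l / 2 * ((w - z) * (w - z)))%C).
  set (S := b - a + (d - c)).
  assert (Hclose : forall s t, a <= s <= b -> c <= t <= d ->
    Cmod (h (s, t) - aff (s, t)) <= e / 2 * S).
  { intros s t Hs Ht.
    assert (Hst : Cmod ((s, t) - z) <= S).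
    { eapply Rle_trans; [apply (Cmod_coord (s - x) (t - y))|].
      unfold S. apply Rplus_le_compat; apply Rabs_le; lra. }
    assert (HS : S < r) by (unfold S; lra).
    specialize (H (s, t) ltac:(lra)). unfold aff.
    replace (h (s, t) - (h z + 2 * (l / 2) * ((s, t) - z)))%C
      with (h (s, t) - h z - ((s, t) - z) * l)%C.
    - eapply Rle_trans; [exact H|]. apply Rmult_le_compat_l; lra.
    - field. }
  assert (HA : forall w, Cderiv A w (aff w)) by (intros w; apply Cderiv_quadratic).
  assert (Haff : forall w, Ccont aff w).
  { intros w. apply Cderiv_Ccont with l. intros eps Heps. exists 1. split; [lra|].
    intros w' _. unfold aff. replace (_ - _)%C with (RtoC 0).
    - rewrite Cmod_0. apply Rmult_le_pos; [lra | apply Cmod_ge_0].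
    - field. }
  assert (HH : forall t, c <= t <= d ->
    Cmod (CInt (fun s => h (s, t)) a b - (A (b, t) - A (a, t))) <= (b - a) * (e / 2 * S)).
  { intros t Ht. rewrite <- (Rabs_pos_eq (b - a)) by lra.
    apply (is_CInt_close (fun s => h (s, t)) (fun s => aff (s, t)));
      rewrite ?Rmin_left, ?Rmax_right by lra.
    - intros s Hs. now apply Hclose.
    - apply CInt_correct. rewrite Rmin_left, Rmax_right by lra. intros s Hs.
      destruct (Hdiff s t Hs Ht) as [l' Hl']. now apply Cderiv_Rcont_horizontal with l'.
    - apply (is_CInt_derive (fun s => A (s, t))).
      + intros s _. rewrite <- (Cmult_1_r (aff (s, t))).
        apply (Cderiv_comp_curve A _ (fun s => (s, t))); [apply HA | apply Rderiv_horizontal].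
      + intros s _. apply (Ccont_comp_curve aff _ (fun s => (s, t))); [apply Haff|].
        apply (Rderiv_Rcont _ _ _ 1), Rderiv_horizontal. }
  assert (HV : forall s, a <= s <= b ->
    Cmod (Ci * CInt (fun t => h (s, t)) c d - (A (s, d) - A (s, c))) <= (d - c) * (e / 2 * S)).
  { intros s Hs.
    assert (HI : is_CInt (fun t => Ci * aff (s, t))%C c d (A (s, d) - A (s, c))%C).
    { apply (is_CInt_derive (fun t => A (s, t))).
      + intros t _. rewrite Cmult_comm.
        apply (Cderiv_comp_curve A _ (fun t => (s, t))); [apply HA | apply Rderiv_vertical].
      + intros t _. apply Rcont_const_mul.
        apply (Ccont_comp_curve aff _ (fun t => (s, t))); [apply Haff|].
        apply (Rderiv_Rcont _ _ _ Ci), Rderiv_vertical. }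
    rewrite <- (Rabs_pos_eq (d - c)) by lra.
    apply (is_CInt_close (fun t => Ci * h (s, t))%C (fun t => Ci * aff (s, t))%C);
      rewrite ?Rmin_left, ?Rmax_right by lra; [| |exact HI].
    - intros t Ht. replace (_ - _)%C with (Ci * (h (s, t) - aff (s, t)))%C by ring.
      rewrite Cmod_mult, Cmod_Ci, Rmult_1_l. now apply Hclose.
    - apply is_CInt_Ci, CInt_correct. rewrite Rmin_left, Rmax_right by lra. intros t Ht.
      destruct (Hdiff s t Hs Ht) as [l' Hl']. now apply Cderiv_Rcont_vertical with l'. }
  unfold boundary_int.
  (* The increments of [A] along the four sides cancel around the rectangle. Each side then
     contributes its length times [e / 2 * S], and the four lengths add up to [2 * S]. *)
  replace (_ - _)%C with
   ((CInt (fun s => h (s, c)) a b - (A (b, c) - A (a, c)))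
    + (Ci * CInt (fun t => h (b, t)) c d - (A (b, d) - A (b, c)))
    - (CInt (fun s => h (s, d)) a b - (A (b, d) - A (a, d)))
    - (Ci * CInt (fun t => h (a, t)) c d - (A (a, d) - A (a, c))))%C by ring.
  eapply Rle_trans; [apply Cmod_minus_le|].
  eapply Rle_trans; [apply Rplus_le_compat_r, Cmod_minus_le|].
  eapply Rle_trans; [apply Rplus_le_compat_r, Rplus_le_compat_r, Cmod_triangle|].
  pose proof (HH c ltac:(lra)). pose proof (HH d ltac:(lra)).
  pose proof (HV a ltac:(lra)). pose proof (HV b ltac:(lra)).
  replace (e * S ^ 2) with ((b - a) * (e / 2 * S) + (d - c) * (e / 2 * S)
    + (b - a) * (e / 2 * S) + (d - c) * (e / 2 * S)) by (unfold S; field).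
  lra.
Qed.

(** The bound [e] times the square of the half-perimeter is additive under quartering: four quarters
    contribute [e * (S / 2)^2] each. It therefore passes through [rect_bisection], with no count of
    the bisection steps, and [e] is arbitrary. *)
Lemma goursat_rectangle (h : C -> C) (a b c d : R) :
  a <= b -> c <= d -> diff_on_rect h a b c d -> boundary_int h a b c d = 0.
Proof.
  intros Hab Hcd Hdiff. apply Cmod_eq_0. apply Rle_antisym; [|apply Cmod_ge_0].
  apply le_epsilon. intros eps Heps. rewrite Rplus_0_l.
  set (S := b - a + (d - c)).
  assert (HS : 0 <= S) by (unfold S; lra).
  set (e := eps / (S ^ 2 + 1)).
  assert (He : 0 < e) by (apply Rdiv_lt_0_compat; nra).
  assert (Hsub : forall a' b' c' d', a <= a' -> b' <= b -> c <= c' -> d' <= d ->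
    diff_on_rect h a' b' c' d') by (intros ? ? ? ? ? ? ? ? x y Hx Hy; apply Hdiff; lra).
  apply Rle_trans with (e * S ^ 2).
  2:{ unfold e. apply Rmult_le_reg_r with (S ^ 2 + 1); [nra|]. field_simplify; nra. }
  revert Hsub. unfold S.
  enough (HP : a <= a -> b <= b -> c <= c -> d <= d ->
    Cmod (boundary_int h a b c d) <= e * (b - a + (d - c)) ^ 2) by (intros; apply HP; lra).
  (* The predicate carries containment in the original rectangle, the only place where [h] is known
     to be differentiable. *)
  apply (rect_bisection (fun a' b' c' d' => a <= a' -> b' <= b -> c <= c' -> d' <= d ->
    Cmod (boundary_int h a' b' c' d') <= e * (b' - a' + (d' - c')) ^ 2) a b c d); [|lra|lra|].
  - intros a' b' c' d' Hab' Hcd' H1 H2 H3 H4 Ha Hb Hc Hd.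
    rewrite (boundary_int_quarters h a' ((a' + b') / 2) b' c' ((c' + d') / 2) d')
      by (try lra; intros x y Hx Hy; apply Hdiff; lra).
    specialize (H1 ltac:(lra) ltac:(lra) ltac:(lra) ltac:(lra)).
    specialize (H2 ltac:(lra) ltac:(lra) ltac:(lra) ltac:(lra)).
    specialize (H3 ltac:(lra) ltac:(lra) ltac:(lra) ltac:(lra)).
    specialize (H4 ltac:(lra) ltac:(lra) ltac:(lra) ltac:(lra)).
    eapply Rle_trans; [apply Cmod_triangle|].
    eapply Rle_trans; [apply Rplus_le_compat_r, Cmod_triangle|].
    eapply Rle_trans; [apply Rplus_le_compat_r, Rplus_le_compat_r, Cmod_triangle|].
    lra.
  - intros x y Hx Hy. destruct (Hdiff x y Hx Hy) as [l Hl].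
    destruct (boundary_int_local h x y e l Hl He) as (r & Hr & H).
    exists r. split; [exact Hr|]. intros. apply H; try lra.
    intros x' y' Hx' Hy'; apply Hdiff; lra.
Qed.

(** Exchanging two opposite sides flips the sign of the boundary integral. The local primitive needs
    this because its corners may lie on any side of the centre. *)
Lemma goursat_rectangle_unordered (h : C -> C) (p q p' q' a b c d : R) :
  diff_on_rect h p q p' q' ->
  p <= a <= q -> p <= b <= q -> p' <= c <= q' -> p' <= d <= q' ->
  boundary_int h a b c d = 0.
Proof.
  intros H.
  assert (HH : forall y a b, p' <= y <= q' -> p <= a <= q -> p <= b <= q ->
    (CInt (fun s => h (s, y)) b a = - CInt (fun s => h (s, y)) a b)%C).
  { intros y a1 b1 Hy Ha Hb. apply (CInt_swap _ p q); [assumption..|]. intros t Ht.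
    destruct (H t y Ht Hy) as [l Hl]. now apply Cderiv_Rcont_horizontal with l. }
  assert (HV : forall x c d, p <= x <= q -> p' <= c <= q' -> p' <= d <= q' ->
    (CInt (fun s => h (x, s)) d c = - CInt (fun s => h (x, s)) c d)%C).
  { intros x c1 d1 Hx Hc Hd. apply (CInt_swap _ p' q'); [assumption..|]. intros t Ht.
    destruct (H x t Hx Ht) as [l Hl]. now apply Cderiv_Rcont_vertical with l. }
  assert (Hsw1 : forall a b c d, p <= a <= q -> p <= b <= q -> p' <= c <= q' -> p' <= d <= q' ->
    boundary_int h b a c d = (- boundary_int h a b c d)%C).
  { intros a1 b1 c1 d1 Ha Hb Hc Hd. unfold boundary_int.
    rewrite (HH c1 a1 b1), (HH d1 a1 b1) by assumption. ring. }
  assert (Hsw2 : forall a b c d, p <= a <= q -> p <= b <= q -> p' <= c <= q' -> p' <= d <= q' ->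
    boundary_int h a b d c = (- boundary_int h a b c d)%C).
  { intros a1 b1 c1 d1 Ha Hb Hc Hd. unfold boundary_int.
    rewrite (HV a1 c1 d1), (HV b1 c1 d1) by assumption. ring. }
  assert (H0 : forall a b c d, p <= a <= b -> b <= q -> p' <= c <= d -> d <= q' ->
    boundary_int h a b c d = 0).
  { intros a1 b1 c1 d1 ? ? ? ?. apply goursat_rectangle; [lra..|].
    intros x y Hx Hy. apply H; lra. }
  intros Ha Hb Hc Hd.
  destruct (Rle_dec a b) as [Hab|Hab]; destruct (Rle_dec c d) as [Hcd|Hcd].
  - apply H0; lra.
  - rewrite Hsw2, H0 by lra. ring.
  - rewrite Hsw1, H0 by lra. ring.
  - rewrite Hsw1, Hsw2, H0 by lra. ring.
Qed.

(** The primitive integrates from the centre first horizontally, then vertically. Goursat reduces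
    its increment between [z] and [w] to two short edges joining them, on which [h] is close to
    [h z]. *)
Lemma Cderiv_local_primitive (h : C -> C) (z0 : C) (r : R) :
  0 < r -> (forall w, Cmod (w - z0) < r -> exists l, Cderiv h w l) ->
  exists F d, 0 < d /\ forall w, Cmod (w - z0) < d -> Cderiv F w (h w).
Proof.
  (* A third of [r] puts the square of half-side [rho] inside the disc, since [rho + rho < r]. *)
  intros Hr Hdiff. destruct z0 as [x0 y0]. set (rho := r / 3).
  assert (Hrect : diff_on_rect h (x0 - rho) (x0 + rho) (y0 - rho) (y0 + rho)).
  { intros x y Hx Hy. apply Hdiff. eapply Rle_lt_trans; [apply (Cmod_coord (x - x0) (y - y0))|].
    apply Rle_lt_trans with (rho + rho); [|unfold rho; lra].
    apply Rplus_le_compat; apply Rabs_le; lra. }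
  exists (fun w => CInt (fun s => h (s, y0)) x0 (fst w)
                   + Ci * CInt (fun t => h (fst w, t)) y0 (snd w))%C.
  exists rho. split; [unfold rho; lra|]. intros [x y] Hz.
  assert (Hin : forall w : C, Cmod (w - (x0, y0)) < rho ->
    x0 - rho <= fst w <= x0 + rho /\ y0 - rho <= snd w <= y0 + rho).
  { intros w Hw. pose proof (Rabs_fst_le (w - (x0, y0))%C) as H1.
    pose proof (Rabs_snd_le (w - (x0, y0))%C) as H2. simpl in H1, H2.
    assert (H3 : Rabs (fst w + - x0) <= rho) by lra.
    assert (H4 : Rabs (snd w + - y0) <= rho) by lra.
    apply Rabs_le_between in H3. apply Rabs_le_between in H4. lra. }
  destruct (Hin _ Hz) as [Hx Hy]. simpl in Hx, Hy.
  destruct (Hrect x y Hx Hy) as [l Hl].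
  intros eps Heps.
  destruct (Cderiv_Ccont _ _ _ Hl (eps / 2) ltac:(lra)) as (d & Hd & Hcont).
  set (z0 := (x0, y0) : C) in *.
  (* Points of the two short edges are within the sum of the coordinate increments of [z], hence
     within [d]; the second bound keeps [w] inside the square. *)
  exists (Rmin (d / 2) (rho - Cmod ((x, y) - z0))).
  split; [apply Rmin_glb_lt; lra|]. intros [x' y'] Hw.
  set (z := (x, y) : C) in *. set (w := (x', y') : C) in *.
  assert (Hw1 : Cmod (w - z) < d / 2) by (eapply Rlt_le_trans; [exact Hw | apply Rmin_l]).
  assert (Hw2 : Cmod (w - z) < rho - Cmod (z - z0))
    by (eapply Rlt_le_trans; [exact Hw | apply Rmin_r]).
  assert (Hwin : Cmod (w - z0) < rho) by (pose proof (Cmod_sub_triangle w z z0); lra).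
  destruct (Hin _ Hwin) as [Hx' Hy']. simpl in Hx', Hy'.
  pose proof (Rabs_fst_le (w - z)%C) as Hxx. pose proof (Rabs_snd_le (w - z)%C) as Hyy.
  change (fst (w - z)%C) with (x' - x) in Hxx. change (snd (w - z)%C) with (y' - y) in Hyy.
  assert (HcH : forall s t, x0 - rho <= s <= x0 + rho -> y0 - rho <= t <= y0 + rho ->
    Rcont (fun _ => True) (fun s => h (s, t)) s).
  { intros s t Hs Ht. destruct (Hrect s t Hs Ht) as [l' Hl'].
    now apply Cderiv_Rcont_horizontal with l'. }
  assert (HcV : forall s t, x0 - rho <= s <= x0 + rho -> y0 - rho <= t <= y0 + rho ->
    Rcont (fun _ => True) (fun t => h (s, t)) t).
  { intros s t Hs Ht. destruct (Hrect s t Hs Ht) as [l' Hl'].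
    now apply Cderiv_Rcont_vertical with l'. }
  assert (Hb : forall p q t, Rmin p q <= t <= Rmax p q -> Rabs (t - p) <= Rabs (q - p)).
  { intros p q t. unfold Rmin, Rmax, Rabs. destruct Rle_dec;
      repeat destruct Rcase_abs; lra. }
  assert (HI1 : Cmod (CInt (fun s => h (s, y)) x x' - RtoC (x' - x) * h z) <= Rabs (x' - x) * (eps / 2)).
  { apply (is_CInt_near_const (fun s => h (s, y))).
    - intros s Hs. left. apply Hcont.
      eapply Rle_lt_trans; [apply (Cmod_coord (s - x) (y - y))|].
      apply Hb in Hs. replace (y - y) with 0 by ring. rewrite Rabs_R0. lra.
    - apply CInt_correct. intros s Hs. apply HcH; [|lra].
      revert Hs; unfold Rmin, Rmax; destruct Rle_dec; lra. }
  assert (HI2 : Cmod (CInt (fun t => h (x', t)) y y' - RtoC (y' - y) * h z) <= Rabs (y' - y) * (eps / 2)).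
  { apply (is_CInt_near_const (fun t => h (x', t))).
    - intros t Ht. left. apply Hcont.
      eapply Rle_lt_trans; [apply (Cmod_coord (x' - x) (t - y))|].
      apply Hb in Ht. lra.
    - apply CInt_correct. intros t Ht. apply HcV; [lra|].
      revert Ht; unfold Rmin, Rmax; destruct Rle_dec; lra. }
  (* This moves the horizontal edge from height [y0] to height [y], where it starts at [z]. *)
  assert (HG : boundary_int h x x' y0 y = 0).
  { apply (goursat_rectangle_unordered h _ _ _ _ _ _ _ _ Hrect); lra. }
  assert (HC1 : (CInt (fun s => h (s, y0)) x0 x' =
    CInt (fun s => h (s, y0)) x0 x + CInt (fun s => h (s, y0)) x x')%C).
  { apply (CInt_chasles _ (x0 - rho) (x0 + rho)); try lra. intros s Hs. apply HcH; lra. }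
  assert (HC2 : (CInt (fun t => h (x', t)) y0 y' =
    CInt (fun t => h (x', t)) y0 y + CInt (fun t => h (x', t)) y y')%C).
  { apply (CInt_chasles _ (y0 - rho) (y0 + rho)); try lra. intros s Hs. apply HcV; lra. }
  simpl fst. simpl snd. rewrite HC1, HC2.
  unfold boundary_int in HG.
  replace (w - z)%C with (RtoC (x' - x) + Ci * RtoC (y' - y))%C at 1
    by (apply injective_projections; simpl; ring).
  match goal with |- Cmod ?e <= _ => replace e with
    ((CInt (fun s => h (s, y)) x x' - RtoC (x' - x) * h z)
     + Ci * (CInt (fun t => h (x', t)) y y' - RtoC (y' - y) * h z)
     + (CInt (fun s => h (s, y0)) x x' + Ci * CInt (fun t => h (x', t)) y0 y -
      CInt (fun s => h (s, y)) x x' - Ci * CInt (fun t => h (x, t)) y0 y))%C by ring end.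
  rewrite HG, Cplus_0_r. eapply Rle_trans; [apply Cmod_triangle|].
  rewrite Cmod_mult, Cmod_Ci, Rmult_1_l. nra.
Qed.

(** * Primitives along continuous maps *)

Lemma Cderiv_minus (F1 F2 : C -> C) (z l1 l2 : C) :
  Cderiv F1 z l1 -> Cderiv F2 z l2 -> Cderiv (fun w => F1 w - F2 w)%C z (l1 - l2)%C.
Proof.
  intros H1 H2 eps Heps.
  destruct (H1 (eps / 2) ltac:(lra)) as (d1 & Hd1 & H1').
  destruct (H2 (eps / 2) ltac:(lra)) as (d2 & Hd2 & H2').
  exists (Rmin d1 d2). split; [now apply Rmin_glb_lt|]. intros w Hw.
  specialize (H1' w (Rlt_le_trans _ _ _ Hw (Rmin_l _ _))).
  specialize (H2' w (Rlt_le_trans _ _ _ Hw (Rmin_r _ _))).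
  replace (_ - _)%C with
    ((F1 w - F1 z - (w - z) * l1) - (F2 w - F2 z - (w - z) * l2))%C by ring.
  eapply Rle_trans; [apply Cmod_minus_le|]. lra.
Qed.

Lemma Cderiv_add_const (F : C -> C) (z l k : C) :
  Cderiv F z l -> Cderiv (fun w => F w + k)%C z l.
Proof.
  intros H eps Heps. destruct (H eps Heps) as (d & Hd & H').
  exists d. split; [exact Hd|]. intros w Hw.
  replace (F w + k - (F z + k))%C with (F w - F z)%C by ring. auto.
Qed.

Definition segment (z w : C) (t : R) : C := (z + RtoC t * (w - z))%C.

Lemma segment_0 (z w : C) : segment z w 0 = z.
Proof. unfold segment. ring. Qed.

Lemma segment_1 (z w : C) : segment z w 1 = w.
Proof. unfold segment. ring. Qed.

Lemma Rderiv_segment (D : R -> Prop) (z w : C) (t : R) :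
  Rderiv D (segment z w) t (w - z)%C.
Proof. apply Rderiv_affine. intros s _. unfold segment. rewrite RtoC_minus. ring. Qed.

Lemma segment_in_ball (z0 z w : C) (r t : R) :
  0 <= t <= 1 -> Cmod (z - z0) < r -> Cmod (w - z0) < r -> Cmod (segment z w t - z0) < r.
Proof.
  intros Ht Hz Hw. unfold segment.
  replace (_ - _)%C with (RtoC (1 - t) * (z - z0) + RtoC t * (w - z0))%C
    by (rewrite RtoC_minus; ring).
  eapply Rle_lt_trans; [apply Cmod_triangle|].
  rewrite !Cmod_mult, !Cmod_R, !Rabs_pos_eq by lra.
  destruct (Rle_lt_dec t (1 / 2)); nra.
Qed.

(** Along the segment from [z] to [w], which stays in the disc, the difference has derivative
    zero. *)
Lemma primitives_differ_by_const (h F1 F2 : C -> C) (z : C) (r : R) :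
  (forall w, Cmod (w - z) < r -> Cderiv F1 w (h w)) ->
  (forall w, Cmod (w - z) < r -> Cderiv F2 w (h w)) ->
  forall w, Cmod (w - z) < r -> (F1 w - F2 w = F1 z - F2 z)%C.
Proof.
  intros H1 H2 w Hw.
  assert (Hr : Cmod (z - z) < r).
  { replace (z - z)%C with (RtoC 0) by ring. rewrite Cmod_0.
    eapply Rle_lt_trans; [apply Cmod_ge_0 | exact Hw]. }
  pose proof (eq_is_derive (V := C_R_NormedModule)
    (fun t => F1 (segment z w t) - F2 (segment z w t))%C 0 1) as H.
  cbv beta in H. rewrite segment_0, segment_1 in H.
  symmetry. apply H; [|lra]. intros t Ht.
  apply (proj2 (is_derive_Rderiv _ t 0)).
  assert (Hs : Cmod (segment z w t - z) < r) by (apply segment_in_ball; assumption).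
  replace (RtoC 0) with ((h (segment z w t) - h (segment z w t)) * (w - z))%C by ring.
  apply (Cderiv_comp_curve (fun v => F1 v - F2 v)%C).
  - apply Cderiv_minus; auto.
  - apply Rderiv_segment.
Qed.

Definition in_rect (a b c d x y : R) : Prop := a <= x <= b /\ c <= y <= d.

Definition cont_on_rect (H : R -> R -> C) (a b c d : R) : Prop :=
  forall x y, in_rect a b c d x y -> forall e, 0 < e -> exists r, 0 < r /\
  forall x' y', in_rect a b c d x' y' -> Rabs (x' - x) < r -> Rabs (y' - y) < r ->
    Cmod (H x' y' - H x y) < e.

(* [Phi] is a continuous choice of local primitives of [h], evaluated along the
   merely continuous map [H]; its increments replace the integral of [h]. *)
Definition primitive_along (h : C -> C) (H Phi : R -> R -> C) (a b c d : R) : Prop :=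
  forall x y, in_rect a b c d x y -> exists F r e, 0 < r /\ 0 < e /\
    (forall w, Cmod (w - H x y) < r -> Cderiv F w (h w)) /\
    forall x' y', in_rect a b c d x' y' -> Rabs (x' - x) < e -> Rabs (y' - y) < e ->
      Phi x' y' = F (H x' y').

Lemma cont_on_rect_sub (H : R -> R -> C) (a b c d a' b' c' d' : R) :
  a <= a' -> b' <= b -> c <= c' -> d' <= d ->
  cont_on_rect H a b c d -> cont_on_rect H a' b' c' d'.
Proof.
  intros Ha Hb Hc Hd HH x y Hxy e He.
  destruct (HH x y ltac:(unfold in_rect in *; lra) e He) as (r & Hr & HH').
  exists r. split; [exact Hr|]. intros x' y' Hxy'. apply HH'. unfold in_rect in *; lra.
Qed.

(** Near each point the difference is that of two primitives on one disc, hence constant; bisection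
    makes the constant global. *)
Lemma primitive_along_unique (h : C -> C) (H Phi1 Phi2 : R -> R -> C) (a b c d : R) :
  cont_on_rect H a b c d ->
  primitive_along h H Phi1 a b c d -> primitive_along h H Phi2 a b c d ->
  forall x y x' y', in_rect a b c d x y -> in_rect a b c d x' y' ->
  (Phi1 x y - Phi2 x y = Phi1 x' y' - Phi2 x' y')%C.
Proof.
  intros HH H1 H2 x0 y0 x0' y0' Hxy0 Hxy0'.
  enough (Hall : exists k, forall x y, in_rect a b c d x y -> (Phi1 x y - Phi2 x y = k)%C).
  { destruct Hall as [k Hk]. now rewrite !Hk. }
  apply (rect_bisection (fun a b c d => exists k, forall x y,
    in_rect a b c d x y -> (Phi1 x y - Phi2 x y = k)%C)).
  - intros a' b' c' d' Hab Hcd [k1 K1] [k2 K2] [k3 K3] [k4 K4].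
    set (m := (a' + b') / 2) in *. set (k := (c' + d') / 2) in *.
    assert (Hm : a' <= m <= b') by (unfold m; lra).
    assert (Hk : c' <= k <= d') by (unfold k; lra).
    exists k1.
    (* The centre [(m, k)] belongs to all four closed quarters and identifies their constants. *)
    assert (k2 = k1) by (rewrite <- (K1 m k), <- (K2 m k); unfold in_rect; lra || easy).
    assert (k3 = k1) by (rewrite <- (K1 m k), <- (K3 m k); unfold in_rect; lra || easy).
    assert (k4 = k1) by (rewrite <- (K1 m k), <- (K4 m k); unfold in_rect; lra || easy).
    subst k2 k3 k4. intros x y [Hx Hy].
    destruct (Rle_dec x m); destruct (Rle_dec y k);
      [apply K1 | apply K3 | apply K2 | apply K4]; unfold in_rect; lra.
  - unfold in_rect in *; lra.
  - unfold in_rect in *; lra.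
  - intros x y Hx Hy. assert (Hxy : in_rect a b c d x y) by (split; assumption).
    destruct (H1 x y Hxy) as (F1 & r1 & e1 & Hr1 & He1 & HF1 & HP1).
    destruct (H2 x y Hxy) as (F2 & r2 & e2 & Hr2 & He2 & HF2 & HP2).
    destruct (HH x y Hxy (Rmin r1 r2)) as (e3 & He3 & HH3); [now apply Rmin_glb_lt|].
    exists (Rmin (Rmin e1 e2) e3). split; [repeat apply Rmin_glb_lt; assumption|].
    intros a' b' c' d' Ha Hb Hc Hd Hab Hcd.
    exists (F1 (H x y) - F2 (H x y))%C. intros x' y' [Hx' Hy'].
    assert (Hxy' : in_rect a b c d x' y') by (unfold in_rect; lra).
    assert (Hdx : Rabs (x' - x) < Rmin (Rmin e1 e2) e3) by (apply Rabs_lt_between; lra).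
    assert (Hdy : Rabs (y' - y) < Rmin (Rmin e1 e2) e3) by (apply Rabs_lt_between; lra).
    pose proof (Rmin_l (Rmin e1 e2) e3). pose proof (Rmin_r (Rmin e1 e2) e3).
    pose proof (Rmin_l e1 e2). pose proof (Rmin_r e1 e2).
    rewrite HP1, HP2 by (assumption || lra).
    apply (primitives_differ_by_const h F1 F2 (H x y) (Rmin r1 r2)).
    + intros w Hw. apply HF1. eapply Rlt_le_trans; [exact Hw | apply Rmin_l].
    + intros w Hw. apply HF2. eapply Rlt_le_trans; [exact Hw | apply Rmin_r].
    + apply HH3; (assumption || lra).
Qed.

(** Uniqueness on the common edge, taken as a rectangle of width zero, says that the two primitives
    differ there by one constant [k]; shifting the second one by [k] makes them fit. *)
Lemma primitive_along_glue (h : C -> C) (H Phi1 Phi2 : R -> R -> C) (a m b c d : R) :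
  a <= m <= b -> c <= d -> cont_on_rect H a b c d ->
  primitive_along h H Phi1 a m c d -> primitive_along h H Phi2 m b c d ->
  exists Phi, primitive_along h H Phi a b c d.
Proof.
  intros Hm Hcd HH H1 H2.
  set (k := (Phi1 m c - Phi2 m c)%C).
  assert (Hedge : forall y, c <= y <= d -> Phi1 m y = (Phi2 m y + k)%C).
  { intros y Hy.
    assert (E : (Phi1 m y - Phi2 m y = k)%C).
    { apply (primitive_along_unique h H Phi1 Phi2 m m c d).
      - apply (cont_on_rect_sub H a b c d); lra || assumption.
      - intros x' y' Hxy'. destruct (H1 x' y' ltac:(unfold in_rect in *; lra))
          as (F & r & e & Hr & He & HF & HP).
        exists F, r, e. repeat split; try assumption. intros. apply HP; unfold in_rect in *; lra.
      - intros x' y' Hxy'. destruct (H2 x' y' ltac:(unfold in_rect in *; lra))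
          as (F & r & e & Hr & He & HF & HP).
        exists F, r, e. repeat split; try assumption. intros. apply HP; unfold in_rect in *; lra.
      - unfold in_rect; lra.
      - unfold in_rect; lra. }
    rewrite <- E. ring. }
  exists (fun x y => if Rle_dec x m then Phi1 x y else Phi2 x y + k)%C.
  intros x y [Hx Hy]. destruct (Rtotal_order x m) as [Hxm|[Hxm|Hxm]].
  - destruct (H1 x y ltac:(unfold in_rect; lra)) as (F & r & e & Hr & He & HF & HP).
    exists F, r, (Rmin e (m - x)). repeat split; try assumption.
    { apply Rmin_glb_lt; lra. }
    intros x' y' [Hx' Hy'] Hdx Hdy.
    pose proof (Rmin_l e (m - x)). pose proof (Rmin_r e (m - x)).
    pose proof (Rle_abs (x' - x)).
    destruct Rle_dec; [|lra]. apply HP; unfold in_rect; lra.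
  (* On the edge [F1] has to serve both sides: near [H m y] it differs from [F2] by a constant, and
     that constant is [k] because of the values at [(m, y)]. *)
  - subst x. destruct (H1 m y ltac:(unfold in_rect; lra)) as (F1 & r1 & e1 & Hr1 & He1 & HF1 & HP1).
    destruct (H2 m y ltac:(unfold in_rect; lra)) as (F2 & r2 & e2 & Hr2 & He2 & HF2 & HP2).
    destruct (HH m y ltac:(unfold in_rect; lra) (Rmin r1 r2)) as (e3 & He3 & HH3);
      [now apply Rmin_glb_lt|].
    exists F1, r1, (Rmin (Rmin e1 e2) e3). repeat split; try assumption.
    { repeat apply Rmin_glb_lt; assumption. }
    intros x' y' Hxy' Hdx Hdy.
    pose proof (Rmin_l (Rmin e1 e2) e3). pose proof (Rmin_r (Rmin e1 e2) e3).
    pose proof (Rmin_l e1 e2). pose proof (Rmin_r e1 e2).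
    destruct Rle_dec as [Hle|Hle].
    + apply HP1; unfold in_rect in *; lra.
    + rewrite HP2 by (unfold in_rect in *; lra).
      pose proof (primitives_differ_by_const h F1 F2 (H m y) (Rmin r1 r2)) as HC.
      assert (E : (F1 (H x' y') - F2 (H x' y') = F1 (H m y) - F2 (H m y))%C).
      { apply HC.
        - intros w Hw. apply HF1. eapply Rlt_le_trans; [exact Hw | apply Rmin_l].
        - intros w Hw. apply HF2. eapply Rlt_le_trans; [exact Hw | apply Rmin_r].
        - apply HH3; (assumption || lra). }
      assert (Hz : Rabs (m - m) < Rmin e1 e2 /\ Rabs (y - y) < Rmin e1 e2).
      { split; rewrite Rminus_diag, Rabs_R0; now apply Rmin_glb_lt. }
      rewrite <- (HP1 m y), <- (HP2 m y), Hedge in E by (unfold in_rect in *; lra).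
      replace k with (Phi2 m y + k - Phi2 m y)%C by ring. rewrite <- E. ring.
  - destruct (H2 x y ltac:(unfold in_rect; lra)) as (F & r & e & Hr & He & HF & HP).
    exists (fun w => F w + k)%C, r, (Rmin e (x - m)). repeat split; try assumption.
    { apply Rmin_glb_lt; lra. }
    { intros w Hw. apply Cderiv_add_const. auto. }
    intros x' y' [Hx' Hy'] Hdx Hdy.
    pose proof (Rmin_l e (x - m)). pose proof (Rmin_r e (x - m)).
    pose proof (Rle_abs (x - x')). rewrite Rabs_minus_sym in Hdx.
    destruct Rle_dec; [lra|]. f_equal.
    apply HP; unfold in_rect; rewrite 1?(Rabs_minus_sym x'); lra.
Qed.

(** Exchanging the variables lets the gluing along a vertical edge serve for horizontal edges as
    well. *)
Lemma primitive_along_transpose (h : C -> C) (H Phi : R -> R -> C) (a b c d : R) :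
  primitive_along h (fun y x => H x y) (fun y x => Phi x y) c d a b ->
  primitive_along h H Phi a b c d.
Proof.
  intros HP x y [Hx Hy]. destruct (HP y x (conj Hy Hx)) as (F & r & e & Hr & He & HF & HP').
  exists F, r, e. repeat split; try assumption. intros x' y' [Hx' Hy'] H1 H2.
  apply (HP' y' x'); try assumption. now split.
Qed.

(** By continuity a small rectangle is mapped into a disc carrying a single primitive [F], and [F]
    composed with [H] works there. Larger rectangles follow by gluing the lower pair of quarters,
    the upper pair, and then the two results. *)
Lemma primitive_along_exists (h : C -> C) (H : R -> R -> C) (a b c d : R) :
  a <= b -> c <= d -> cont_on_rect H a b c d ->
  (forall x y, in_rect a b c d x y -> exists F r, 0 < r /\
     forall w, Cmod (w - H x y) < r -> Cderiv F w (h w)) ->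
  exists Phi, primitive_along h H Phi a b c d.
Proof.
  intros Hab Hcd HH Hloc.
  enough (HP : a <= a -> b <= b -> c <= c -> d <= d ->
    exists Phi, primitive_along h H Phi a b c d) by (apply HP; lra).
  apply (rect_bisection (fun a' b' c' d' => a <= a' -> b' <= b -> c <= c' -> d' <= d ->
    exists Phi, primitive_along h H Phi a' b' c' d') a b c d); [|lra|lra|].
  - intros a' b' c' d' Hab' Hcd' H1 H2 H3 H4 Ha Hb Hc Hd.
    set (m := (a' + b') / 2) in *. set (k := (c' + d') / 2) in *.
    assert (Hm : a' <= m <= b') by (unfold m; lra).
    assert (Hk : c' <= k <= d') by (unfold k; lra).
    destruct H1 as [P1 H1]; try lra. destruct H2 as [P2 H2]; try lra.
    destruct H3 as [P3 H3]; try lra. destruct H4 as [P4 H4]; try lra.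
    destruct (primitive_along_glue h H P1 P2 a' m b' c' k) as [P12 H12];
      try lra; try assumption.
    { apply (cont_on_rect_sub H a b c d); lra || assumption. }
    destruct (primitive_along_glue h H P3 P4 a' m b' k d') as [P34 H34];
      try lra; try assumption.
    { apply (cont_on_rect_sub H a b c d); lra || assumption. }
    destruct (primitive_along_glue h (fun y x => H x y) (fun y x => P12 x y)
      (fun y x => P34 x y) c' k d' a' b') as [P HP]; try lra.
    + intros y x [Hy Hx] e He.
      destruct (HH x y ltac:(unfold in_rect; lra) e He) as (r & Hr & HH').
      exists r. split; [exact Hr|]. intros y' x' [Hy' Hx'] Hdy Hdx.
      apply HH'; unfold in_rect; lra.
    + now apply primitive_along_transpose.
    + now apply primitive_along_transpose.
    + exists (fun x y => P y x). now apply primitive_along_transpose.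
  - intros x y Hx Hy. destruct (Hloc x y (conj Hx Hy)) as (F & r & Hr & HF).
    destruct (HH x y (conj Hx Hy) (r / 2) ltac:(lra)) as (e & He & HH').
    exists e. split; [exact He|]. intros a' b' c' d' Ha Hb Hc Hd Hab' Hcd' _ _ _ _.
    exists (fun x y => F (H x y)). intros x' y' [Hx' Hy'].
    (* The disc of radius [r / 2] around [H x' y'] lies in the disc of radius [r] around [H x y]. *)
    exists F, (r / 2), 1. repeat split; try lra.
    intros w Hw. apply HF. eapply Rle_lt_trans; [apply (Cmod_sub_triangle _ (H x' y'))|].
    assert (Cmod (H x' y' - H x y) < r / 2).
    { apply HH'; [unfold in_rect; lra | apply Rabs_lt_between; lra
        | apply Rabs_lt_between; lra]. }
    lra.
Qed.

(** Pullback by a Lipschitz change of parameters. Subintervals, edges of a square and the two halves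
    of a loop are all instances. *)
Lemma primitive_along_comp (h : C -> C) (H Phi : R -> R -> C) (a b c d : R)
    (p q : R -> R -> R) (K a' b' c' d' : R) :
  0 < K ->
  (forall x y, in_rect a' b' c' d' x y -> in_rect a b c d (p x y) (q x y)) ->
  (forall x y x' y', Rabs (p x' y' - p x y) <= K * (Rabs (x' - x) + Rabs (y' - y))) ->
  (forall x y x' y', Rabs (q x' y' - q x y) <= K * (Rabs (x' - x) + Rabs (y' - y))) ->
  primitive_along h H Phi a b c d ->
  forall H' Phi',
  (forall x y, in_rect a' b' c' d' x y -> H' x y = H (p x y) (q x y)) ->
  (forall x y, in_rect a' b' c' d' x y -> Phi' x y = Phi (p x y) (q x y)) ->
  primitive_along h H' Phi' a' b' c' d'.
Proof.
  intros HK Hpq Hp Hq HP H' Phi' EH EP x y Hxy.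
  destruct (HP _ _ (Hpq x y Hxy)) as (F & r & e & Hr & He & HF & HP').
  exists F, r, (e / (2 * K)). rewrite EH by exact Hxy.
  repeat split; try assumption. { apply Rdiv_lt_0_compat; lra. }
  intros x' y' Hxy' H1 H2. rewrite EH, EP by exact Hxy'.
  assert (HE : K * (Rabs (x' - x) + Rabs (y' - y)) < e).
  { replace e with (K * (e / (2 * K) + e / (2 * K))) by (field; lra).
    apply Rmult_lt_compat_l; lra. }
  apply HP'; [auto | eapply Rle_lt_trans; [apply Hp | exact HE]
    | eapply Rle_lt_trans; [apply Hq | exact HE]].
Qed.

(** * Integration along curves *)

Lemma C1_on_iff (gamma : R -> C) (a b : R) :
  C1_on gamma a b <-> exists dgamma : R -> C,
    (forall t, a <= t <= b -> Rcont (fun s => a <= s <= b) dgamma t) /\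
    (forall t, a <= t <= b -> Rderiv (fun s => a <= s <= b) gamma t (dgamma t)).
Proof.
  split; intros (dg & H1 & H2); exists dg; split.
  - now apply continuous_on_Rcont.
  - intros t Ht. now apply filterdiff_Rderiv, H2.
  - now apply continuous_on_Rcont.
  - intros t Ht. apply filterdiff_Rderiv; auto.
Qed.

Lemma Rcont_mul (D : R -> Prop) (f g : R -> C) (t : R) :
  Rcont D f t -> Rcont D g t -> Rcont D (fun s => f s * g s)%C t.
Proof.
  intros Hf Hg eps Heps.
  pose proof (Cmod_ge_0 (f t)) as Hf0. pose proof (Cmod_ge_0 (g t)) as Hg0.
  (* With both factors within [e <= 1], the three error terms add up to less than [e * S]. *)
  set (S := 1 + Cmod (f t) + Cmod (g t)).
  assert (HS : 0 < S) by (unfold S; lra).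
  set (e := Rmin 1 (eps / S)).
  assert (He : 0 < e) by (apply Rmin_glb_lt; [lra | now apply Rdiv_lt_0_compat]).
  assert (He1 : e <= 1) by apply Rmin_l.
  assert (HeS : e * S <= eps).
  { apply Rle_trans with (eps / S * S); [apply Rmult_le_compat_r; [lra | apply Rmin_r]|].
    right. field. lra. }
  destruct (Hf e He) as (d1 & Hd1 & H1). destruct (Hg e He) as (d2 & Hd2 & H2).
  exists (Rmin d1 d2). split; [now apply Rmin_glb_lt|]. intros s Hs Hst.
  specialize (H1 s Hs (Rlt_le_trans _ _ _ Hst (Rmin_l _ _))).
  specialize (H2 s Hs (Rlt_le_trans _ _ _ Hst (Rmin_r _ _))).
  replace (f s * g s - f t * g t)%C
    with ((f s - f t) * (g s - g t) + (f s - f t) * g t + f t * (g s - g t))%C by ring.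
  eapply Rle_lt_trans; [apply Cmod_triangle|].
  eapply Rle_lt_trans; [apply Rplus_le_compat_r, Cmod_triangle|].
  rewrite !Cmod_mult. pose proof (Cmod_ge_0 (f s - f t)). pose proof (Cmod_ge_0 (g s - g t)).
  unfold S in HeS. nra.
Qed.

(** Nearest-point projection onto the interval. Composing with it extends functions to the whole
    line, where the theorems on two-sided derivatives and integrals apply. *)
Definition clamp (a b t : R) : R := Rmax a (Rmin b t).

Lemma clamp_in (a b t : R) : a <= b -> a <= clamp a b t <= b.
Proof. intros H. unfold clamp, Rmax, Rmin. repeat destruct Rle_dec; lra. Qed.

Lemma clamp_id (a b t : R) : a <= t <= b -> clamp a b t = t.
Proof. intros H. unfold clamp, Rmax, Rmin. repeat destruct Rle_dec; lra. Qed.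

Lemma clamp_contract (a b s t : R) :
  a <= b -> Rabs (clamp a b s - clamp a b t) <= Rabs (s - t).
Proof.
  intros H. unfold clamp, Rmax, Rmin, Rabs.
  repeat destruct Rle_dec; repeat destruct Rcase_abs; lra.
Qed.

Lemma clamp_defect (a b s t : R) :
  a <= t <= b -> Rabs (s - clamp a b s) <= Rabs (s - t).
Proof.
  intros H. unfold clamp, Rmax, Rmin, Rabs.
  repeat destruct Rle_dec; repeat destruct Rcase_abs; lra.
Qed.

Lemma Rcont_clamp (f : R -> C) (a b t : R) :
  a <= b -> (forall s, a <= s <= b -> Rcont (fun s => a <= s <= b) f s) ->
  Rcont (fun _ => True) (fun s => f (clamp a b s)) t.
Proof.
  intros Hab H eps Heps.
  destruct (H (clamp a b t) (clamp_in a b t Hab) eps Heps) as (d & Hd & H').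
  exists d. split; [exact Hd|]. intros s _ Hs. apply H'; [now apply clamp_in|].
  eapply Rle_lt_trans; [now apply clamp_contract | exact Hs].
Qed.

(* [f] is extended to a function differentiable on the whole line by
   its tangents at the end points. *)
Lemma is_CInt_derive_within (f df : R -> C) (a b s t : R) :
  a <= s -> s <= t -> t <= b ->
  (forall t, a <= t <= b -> Rcont (fun s => a <= s <= b) df t) ->
  (forall t, a <= t <= b -> Rderiv (fun s => a <= s <= b) f t (df t)) ->
  is_CInt df s t (f t - f s)%C.
Proof.
  intros Hs Hst Ht Hc Hd.
  set (g := fun x => (f (clamp a b x) + RtoC (x - clamp a b x) * df (clamp a b x))%C).
  assert (Hg : forall x, a <= x <= b -> g x = f x).
  { intros x Hx. unfold g. rewrite clamp_id by exact Hx.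
    replace (x - x) with 0 by ring. ring. }
  rewrite <- (Hg s), <- (Hg t) by lra.
  apply (is_RInt_ext (fun x => df (clamp a b x))).
  { intros x. rewrite Rmin_left, Rmax_right by lra. intros Hx. now rewrite clamp_id by lra. }
  apply is_CInt_derive.
  - intros x. rewrite Rmin_left, Rmax_right by lra. intros Hx.
    intros eps Heps.
    destruct (Hd x ltac:(lra) (eps / 2) ltac:(lra)) as (d1 & Hd1 & H1).
    destruct (Hc x ltac:(lra) (eps / 2) ltac:(lra)) as (d2 & Hd2 & H2).
    exists (Rmin d1 d2). split; [now apply Rmin_glb_lt|]. intros y _ Hy.
    rewrite (Hg x) by lra. rewrite (clamp_id a b x) by lra.
    assert (Hcy : Rabs (clamp a b y - x) <= Rabs (y - x)).
    { rewrite <- (clamp_id a b x) at 1 by lra. apply clamp_contract; lra. }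
    specialize (H1 (clamp a b y) (clamp_in a b y ltac:(lra))
      ltac:(eapply Rle_lt_trans; [exact Hcy | eapply Rlt_le_trans; [exact Hy | apply Rmin_l]])).
    specialize (H2 (clamp a b y) (clamp_in a b y ltac:(lra))
      ltac:(eapply Rle_lt_trans; [exact Hcy | eapply Rlt_le_trans; [exact Hy | apply Rmin_r]])).
    unfold g.
    (* Two errors: the remainder of [f] at the clamped point, and the overshoot times the variation
       of [df]. Both lengths involved are at most [Rabs (y - x)]. *)
    replace (_ - _)%C with
      ((f (clamp a b y) - f x - RtoC (clamp a b y - x) * df x)
       + RtoC (y - clamp a b y) * (df (clamp a b y) - df x))%C
      by (rewrite !RtoC_minus; ring).
    eapply Rle_trans; [apply Cmod_triangle|]. rewrite Cmod_mult, Cmod_R.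
    pose proof (clamp_defect a b y x ltac:(lra)). pose proof (Rabs_pos (y - clamp a b y)).
    pose proof (Rabs_pos (y - x)). nra.
  - intros x _. apply Rcont_clamp; [lra | exact Hc].
Qed.

Lemma Rderiv_coord (p : C -> R) (f : R -> C) (t : R) (l : C) :
  (forall z w, p (z - w)%C = p z - p w) -> (forall r z, p (RtoC r * z)%C = r * p z) ->
  (forall z, Rabs (p z) <= Cmod z) ->
  Rderiv (fun _ => True) f t l -> is_derive (fun s => p (f s)) t (p l).
Proof.
  intros Hp1 Hp2 Hp3 H. split; [apply (is_linear_scal_l (V := R_NormedModule))|].
  intros x Hx. apply (is_filter_lim_locally_unique (V := R_NormedModule)) in Hx.
  subst x. intros eps. destruct (H eps (cond_pos eps)) as (d & Hd & Hd').
  exists (mkposreal d Hd). intros s Hs. specialize (Hd' s I Hs).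
  apply Rle_trans with (2 := Hd'). eapply Rle_trans; [|apply Hp3].
  rewrite !Hp1, Hp2. apply Rle_refl.
Qed.

(** At an interior point the relative derivative is two-sided. At the ends of a piece nothing is
    claimed, since [Derive] may return an unrelated value there. *)
Lemma velocity_eq (gamma : R -> C) (a b t : R) (l : C) :
  a < t < b -> Rderiv (fun s => a <= s <= b) gamma t l -> velocity gamma t = l.
Proof.
  intros Ht H.
  assert (H' : Rderiv (fun _ => True) gamma t l).
  { intros eps Heps. destruct (H eps Heps) as (d & Hd & Hd').
    exists (Rmin d (Rmin (t - a) (b - t))).
    split; [repeat apply Rmin_glb_lt; lra|]. intros s _ Hs.
    pose proof (Rmin_l d (Rmin (t - a) (b - t))). pose proof (Rmin_r d (Rmin (t - a) (b - t))).
    pose proof (Rmin_l (t - a) (b - t)). pose proof (Rmin_r (t - a) (b - t)).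
    apply Hd'; [|lra]. assert (Hs' : Rabs (s - t) < Rmin (t - a) (b - t)) by lra.
    apply Rabs_lt_between in Hs'. lra. }
  unfold velocity. rewrite (surjective_pairing l). f_equal; apply is_derive_unique.
  - apply (Rderiv_coord Re); [| |exact Rabs_fst_le|exact H'];
      intros; unfold Re; simpl; ring.
  - apply (Rderiv_coord Im); [| |exact Rabs_snd_le|exact H'];
      intros; unfold Im; simpl; ring.
Qed.

Lemma piecewise_C1_lt (gamma : R -> C) (a b : R) : piecewise_C1 gamma a b -> a < b.
Proof. induction 1; lra. Qed.

Lemma Rcont_glue (f : R -> C) (a b c : R) :
  a <= b <= c ->
  (forall t, a <= t <= b -> Rcont (fun s => a <= s <= b) f t) ->
  (forall t, b <= t <= c -> Rcont (fun s => b <= s <= c) f t) ->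
  forall t, a <= t <= c -> Rcont (fun s => a <= s <= c) f t.
Proof.
  intros Hb H1 H2 t Ht eps Heps. destruct (Rtotal_order t b) as [Htb|[Htb|Htb]].
  - destruct (H1 t ltac:(lra) eps Heps) as (d & Hd & H).
    exists (Rmin d (b - t)). split; [apply Rmin_glb_lt; lra|]. intros s Hs Hst.
    pose proof (Rmin_l d (b - t)). pose proof (Rmin_r d (b - t)).
    pose proof (Rle_abs (s - t)). apply H; lra.
  - subst t. destruct (H1 b ltac:(lra) eps Heps) as (d & Hd & H).
    destruct (H2 b ltac:(lra) eps Heps) as (d' & Hd' & H').
    exists (Rmin d d'). split; [apply Rmin_glb_lt; lra|]. intros s Hs Hst.
    pose proof (Rmin_l d d'). pose proof (Rmin_r d d').
    destruct (Rle_dec s b); [apply H | apply H']; lra.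
  - destruct (H2 t ltac:(lra) eps Heps) as (d & Hd & H).
    exists (Rmin d (t - b)). split; [apply Rmin_glb_lt; lra|]. intros s Hs Hst.
    pose proof (Rmin_l d (t - b)). pose proof (Rmin_r d (t - b)).
    rewrite Rabs_minus_sym in Hst. pose proof (Rle_abs (t - s)).
    apply H; [lra|]. rewrite Rabs_minus_sym. lra.
Qed.

Lemma piecewise_C1_Rcont (gamma : R -> C) (a b : R) :
  piecewise_C1 gamma a b ->
  forall t, a <= t <= b -> Rcont (fun s => a <= s <= b) gamma t.
Proof.
  induction 1 as [a b Hab HC | a b c H1 IH1 H2 IH2].
  - apply C1_on_iff in HC. destruct HC as (dg & _ & Hd). intros t Ht.
    now apply Rderiv_Rcont with (dg t), Hd.
  - apply piecewise_C1_lt in H1. apply piecewise_C1_lt in H2.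
    apply (Rcont_glue gamma a b c); [lra | assumption | assumption].
Qed.

(** The first side of the rectangle is the single point 0, so everything proved for maps on
    rectangles applies to curves. *)
Definition curve_primitive (h : C -> C) (gamma phi : R -> C) (a b : R) : Prop :=
  primitive_along h (fun _ t => gamma t) (fun _ t => phi t) 0 0 a b.

Lemma cont_on_rect_curve (gamma : R -> C) (a b : R) :
  (forall t, a <= t <= b -> Rcont (fun s => a <= s <= b) gamma t) ->
  cont_on_rect (fun _ t => gamma t) 0 0 a b.
Proof.
  intros H x t [_ Ht] e He. destruct (H t Ht e He) as (d & Hd & H').
  exists d. split; [exact Hd|]. intros x' t' [_ Ht'] _ Htt. now apply H'.
Qed.

Lemma curve_primitive_reparam (h : C -> C) (H Phi : R -> R -> C) (a b c d : R)
    (p q : R -> R) (a' b' : R) (gamma phi : R -> C) :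
  primitive_along h H Phi a b c d ->
  (forall t, a' <= t <= b' -> in_rect a b c d (p t) (q t)) ->
  (forall s t, Rabs (p s - p t) <= 2 * Rabs (s - t)) ->
  (forall s t, Rabs (q s - q t) <= 2 * Rabs (s - t)) ->
  (forall t, a' <= t <= b' -> gamma t = H (p t) (q t)) ->
  (forall t, a' <= t <= b' -> phi t = Phi (p t) (q t)) ->
  curve_primitive h gamma phi a' b'.
Proof.
  intros HP Hpq Hp Hq Hg Hphi.
  apply (primitive_along_comp h H Phi a b c d (fun _ t => p t) (fun _ t => q t) 2);
    [lra | | | | exact HP | |].
  - intros x t [_ Ht]. auto.
  - intros x y x' y'. eapply Rle_trans; [apply Hp|]. pose proof (Rabs_pos (x' - x)). lra.
  - intros x y x' y'. eapply Rle_trans; [apply Hq|]. pose proof (Rabs_pos (x' - x)). lra.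
  - intros x t [_ Ht]. auto.
  - intros x t [_ Ht]. auto.
Qed.

Lemma curve_primitive_affine (h : C -> C) (gamma phi gamma' phi' : R -> C)
    (a b a' b' p q : R) :
  curve_primitive h gamma phi a b -> Rabs p <= 2 ->
  (forall t, a' <= t <= b' -> a <= p * t + q <= b) ->
  (forall t, a' <= t <= b' -> gamma' t = gamma (p * t + q)) ->
  (forall t, a' <= t <= b' -> phi' t = phi (p * t + q)) ->
  curve_primitive h gamma' phi' a' b'.
Proof.
  intros HP Hp Hin Hg Hphi.
  apply (curve_primitive_reparam h _ _ 0 0 a b (fun _ => 0) (fun t => p * t + q) _ _ _ _ HP).
  - intros t Ht. specialize (Hin t Ht). unfold in_rect; lra.
  - intros s t. rewrite Rminus_diag, Rabs_R0. pose proof (Rabs_pos (s - t)). lra.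
  - intros s t. replace (p * s + q - (p * t + q)) with (p * (s - t)) by ring.
    rewrite Rabs_mult. apply Rmult_le_compat_r; [apply Rabs_pos | exact Hp].
  - exact Hg.
  - exact Hphi.
Qed.

Lemma curve_primitive_unique (h : C -> C) (gamma phi1 phi2 : R -> C) (a b : R) :
  a <= b -> (forall t, a <= t <= b -> Rcont (fun s => a <= s <= b) gamma t) ->
  curve_primitive h gamma phi1 a b -> curve_primitive h gamma phi2 a b ->
  (phi1 b - phi1 a = phi2 b - phi2 a)%C.
Proof.
  intros Hab Hc H1 H2.
  pose proof (primitive_along_unique h _ _ _ 0 0 a b (cont_on_rect_curve _ _ _ Hc) H1 H2
    0 a 0 b ltac:(unfold in_rect; lra) ltac:(unfold in_rect; lra)) as E. cbv beta in E.
  replace (phi1 b - phi1 a)%C with ((phi1 b - phi2 b) - (phi1 a - phi2 a) + (phi2 b - phi2 a))%C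
    by ring. rewrite E. ring.
Qed.

(** Near [t] the function [phi] is a local primitive [F] composed with [gamma], so this is the chain
    rule. *)
Lemma curve_primitive_Rderiv (h : C -> C) (gamma phi : R -> C) (a b t : R) (v : C) :
  curve_primitive h gamma phi a b -> a <= t <= b ->
  Rderiv (fun s => a <= s <= b) gamma t v ->
  Rderiv (fun s => a <= s <= b) phi t (h (gamma t) * v)%C.
Proof.
  intros HP Ht Hg. destruct (HP 0 t ltac:(unfold in_rect; lra)) as (F & r & e & Hr & He & HF & HP').
  assert (HF' : Cderiv F (gamma t) (h (gamma t))).
  { apply HF. replace (gamma t - gamma t)%C with (RtoC 0) by ring. now rewrite Cmod_0. }
  assert (Hval : forall s, a <= s <= b -> Rabs (s - t) < e -> phi s = F (gamma s)).
  { intros s Hs Hst. apply (HP' 0 s); [unfold in_rect; lra| |exact Hst].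
    now rewrite Rminus_diag, Rabs_R0. }
  intros eps Heps.
  destruct (Cderiv_comp_curve F _ gamma t _ v HF' Hg eps Heps) as (d & Hd & H').
  exists (Rmin d e). split; [now apply Rmin_glb_lt|]. intros s Hs Hst.
  rewrite (Hval s), (Hval t); [|exact Ht|now rewrite Rminus_diag, Rabs_R0|exact Hs|].
  - apply H'; [exact Hs|]. eapply Rlt_le_trans; [exact Hst | apply Rmin_l].
  - eapply Rlt_le_trans; [exact Hst | apply Rmin_r].
Qed.

(** Each C^1 piece is the fundamental theorem of calculus, and the increments telescope at the break
    points. The integrands are compared only inside a piece, where [velocity] is reliable. *)
Lemma curve_primitive_is_CInt (h : C -> C) (gamma phi : R -> C) (a b : R) :
  piecewise_C1 gamma a b -> (forall t, a <= t <= b -> Ccont h (gamma t)) ->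
  curve_primitive h gamma phi a b ->
  is_CInt (fun t => h (gamma t) * velocity gamma t)%C a b (phi b - phi a)%C.
Proof.
  induction 1 as [a b Hab HC | a b c H1 IH1 H2 IH2]; intros Hh HP.
  - apply C1_on_iff in HC. destruct HC as (dg & Hc & Hd).
    apply (is_RInt_ext (fun t => h (gamma t) * dg t)%C).
    { intros t. rewrite Rmin_left, Rmax_right by lra. intros Ht.
      now rewrite (velocity_eq gamma a b t (dg t)) by (try apply Hd; lra). }
    apply (is_CInt_derive_within phi _ a b); [lra..| |].
    + intros t Ht. apply Rcont_mul; [|auto].
      apply Ccont_comp_curve; [auto|]. now apply Rderiv_Rcont with (dg t), Hd.
    + intros t Ht. apply curve_primitive_Rderiv; auto.
  - apply piecewise_C1_lt in H1. apply piecewise_C1_lt in H2.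
    replace (phi c - phi a)%C with ((phi b - phi a) + (phi c - phi b))%C by ring.
    apply (is_RInt_Chasles (V := C_R_NormedModule) _ a b c).
    + apply IH1; [intros; apply Hh; lra|].
      apply (curve_primitive_affine h gamma phi _ _ a c _ _ 1 0);
        [exact HP | rewrite Rabs_R1; lra | intros; lra | |]; intros; f_equal; ring.
    + apply IH2; [intros; apply Hh; lra|].
      apply (curve_primitive_affine h gamma phi _ _ a c _ _ 1 0);
        [exact HP | rewrite Rabs_R1; lra | intros; lra | |]; intros; f_equal; ring.
Qed.

(** * Cauchy's theorem on simply connected domains *)

Definition Cdiff_on (U : C -> Prop) (h : C -> C) : Prop :=
  forall z, U z -> exists l, Cderiv h z l.

Lemma open_Cball (U : C -> Prop) (z : C) :
  open (T := C_UniformSpace) U -> U z ->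
  exists r, 0 < r /\ forall w, Cmod (w - z) < r -> U w.
Proof. intros HU Hz. now apply locally_Cmod, HU. Qed.

Lemma Cdiff_on_local_primitive (U : C -> Prop) (h : C -> C) (z : C) :
  open (T := C_UniformSpace) U -> Cdiff_on U h -> U z ->
  exists F r, 0 < r /\ forall w, Cmod (w - z) < r -> Cderiv F w (h w).
Proof.
  intros HU Hh Hz. destruct (open_Cball U z HU Hz) as (r & Hr & HrU).
  apply (Cderiv_local_primitive h z r Hr). auto.
Qed.

Lemma Cdiff_on_Ccont (U : C -> Prop) (h : C -> C) (z : C) :
  Cdiff_on U h -> U z -> Ccont h z.
Proof. intros Hh Hz. destruct (Hh z Hz) as [l Hl]. now apply Cderiv_Ccont with l. Qed.

Lemma curve_primitive_exists (U : C -> Prop) (h : C -> C) (gamma : R -> C) (a b : R) :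
  open (T := C_UniformSpace) U -> Cdiff_on U h -> a <= b ->
  (forall t, a <= t <= b -> Rcont (fun s => a <= s <= b) gamma t) ->
  (forall t, a <= t <= b -> U (gamma t)) ->
  exists phi, curve_primitive h gamma phi a b.
Proof.
  intros HU Hh Hab Hc HgU.
  destruct (primitive_along_exists h (fun _ t => gamma t) 0 0 a b) as [Phi HPhi].
  - lra.
  - exact Hab.
  - now apply cont_on_rect_curve.
  - intros x t [_ Ht]. apply (Cdiff_on_local_primitive U); auto.
  - exists (fun t => Phi 0 t).
    apply (curve_primitive_reparam h _ Phi 0 0 a b (fun _ => 0) (fun t => t) _ _ _ _ HPhi).
    + intros t Ht. unfold in_rect; lra.
    + intros s t. rewrite Rminus_diag, Rabs_R0. pose proof (Rabs_pos (s - t)). lra.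
    + intros s t. pose proof (Rabs_pos (s - t)). lra.
    + reflexivity.
    + reflexivity.
Qed.

(** Along a constant curve a constant function is a primitive too, so by uniqueness every primitive
    has increment zero. *)
Lemma primitive_along_const_edge (h : C -> C) (H Phi : R -> R -> C) (a b c d : R)
    (p q : R -> R) (k : C) :
  primitive_along h H Phi a b c d ->
  (forall t, 0 <= t <= 1 -> in_rect a b c d (p t) (q t)) ->
  (forall s t, Rabs (p s - p t) <= 2 * Rabs (s - t)) ->
  (forall s t, Rabs (q s - q t) <= 2 * Rabs (s - t)) ->
  (forall t, 0 <= t <= 1 -> H (p t) (q t) = k) ->
  Phi (p 1) (q 1) = Phi (p 0) (q 0).
Proof.
  intros HP Hpq Hp Hq Hk.
  destruct (HP _ _ (Hpq 0 ltac:(lra))) as (F & r & e & Hr & He & HF & _).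
  rewrite Hk in HF by lra.
  assert (E : (Phi (p 1) (q 1) - Phi (p 0) (q 0) = F k - F k)%C).
  { apply (curve_primitive_unique h (fun _ => k) (fun t => Phi (p t) (q t)) (fun _ => F k) 0 1).
    - lra.
    - intros t _ eps Heps. exists 1. split; [lra|]. intros s _ _.
      replace (k - k)%C with (RtoC 0) by ring. now rewrite Cmod_0.
    - apply (curve_primitive_reparam h H Phi a b c d p q 0 1); auto.
      intros t Ht. symmetry; auto.
    - intros x t Hxt. exists F, r, 1. repeat split; try lra. exact HF. }
  replace (Phi (p 1) (q 1)) with ((Phi (p 1) (q 1) - Phi (p 0) (q 0)) + Phi (p 0) (q 0))%C by ring.
  rewrite E. ring.
Qed.

Lemma cont_on_rect_square (H : R * R -> C) :
  continuous_on (T := prod_UniformSpace R_UniformSpace R_UniformSpace)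
    (U := C_UniformSpace) unit_square H ->
  cont_on_rect (fun s t => H (s, t)) 0 1 0 1.
Proof.
  intros HH s t [Hs Ht] e He.
  destruct (HH (s, t) (conj Hs Ht) _ (proj2 (locally_Cmod (fun w => Cmod (w - H (s, t)) < e) (H (s, t)))
    (ex_intro _ e (conj He (fun w Hw => Hw))))) as [d Hd].
  exists d. split; [apply cond_pos|]. intros s' t' [Hs' Ht'] H1 H2.
  apply (Hd (s', t')); now split.
Qed.

Lemma simply_connected_path_independence (U : C -> Prop) (h : C -> C) (u x : C)
    (g1 g2 p1 p2 : R -> C) :
  open (T := C_UniformSpace) U -> simply_connected U -> Cdiff_on U h ->
  curve_in U u x g1 -> curve_in U u x g2 ->
  curve_primitive h g1 p1 0 1 -> curve_primitive h g2 p2 0 1 ->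
  (p1 1 - p1 0 = p2 1 - p2 0)%C.
Proof.
  intros HU Hsc Hh (C1 & U1 & g10 & g11) (C2 & U2 & g20 & g21) P1 P2.
  pose proof (piecewise_C1_Rcont _ _ _ C1) as K1. pose proof (piecewise_C1_Rcont _ _ _ C2) as K2.
  (* The loop runs through [g1] and then back along [g2], each at double speed. *)
  set (loop := fun t => if Rle_dec t (1 / 2) then g1 (2 * t) else g2 (2 - 2 * t)).
  assert (L1 : forall t, t <= 1 / 2 -> loop t = g1 (2 * t)).
  { intros t Ht. unfold loop. destruct Rle_dec; [reflexivity | lra]. }
  assert (L2 : forall t, 1 / 2 <= t -> loop t = g2 (2 - 2 * t)).
  { intros t Ht. unfold loop. destruct Rle_dec; [|reflexivity].
    replace t with (1 / 2) by lra. replace (2 * (1 / 2)) with 1 by field.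
    replace (2 - 1) with 1 by ring. congruence. }
  destruct (Hsc loop) as (H & HcH & HHU & H0 & H1 & Hs).
  - apply continuous_on_Rcont. apply (Rcont_glue loop 0 (1 / 2) 1); [lra| |].
    + intros t Ht eps Heps. destruct (K1 (2 * t) ltac:(lra) eps Heps) as (d & Hd & H').
      exists (d / 2). split; [lra|]. intros s Hs Hst. rewrite !L1 by lra.
      apply H'; [lra|]. replace (2 * s - 2 * t) with (2 * (s - t)) by ring.
      rewrite Rabs_mult, (Rabs_pos_eq 2) by lra. lra.
    + intros t Ht eps Heps. destruct (K2 (2 - 2 * t) ltac:(lra) eps Heps) as (d & Hd & H').
      exists (d / 2). split; [lra|]. intros s Hs Hst. rewrite !L2 by lra.
      apply H'; [lra|]. replace (2 - 2 * s - (2 - 2 * t)) with (- (2 * (s - t))) by ring.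
      rewrite Rabs_Ropp, Rabs_mult, (Rabs_pos_eq 2) by lra. lra.
  - intros t [Ht0 Ht1]. destruct (Rle_dec t (1 / 2)).
    + rewrite L1 by lra. apply U1. split; lra.
    + rewrite L2 by lra. apply U2. split; lra.
  - rewrite L1, L2 by lra. rewrite Rmult_0_r. replace (2 - 2 * 1) with 0 by ring. congruence.
  - assert (HcR := cont_on_rect_square H HcH).
    destruct (primitive_along_exists h (fun s t => H (s, t)) 0 1 0 1) as [Phi HPhi];
      [lra | lra | exact HcR | |].
    { intros s t Hst. apply (Cdiff_on_local_primitive U); auto. }
    assert (Lip0 : forall k s t : R, Rabs (k - k) <= 2 * Rabs (s - t)).
    { intros k s t. rewrite Rminus_diag, Rabs_R0. pose proof (Rabs_pos (s - t)). lra. }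
    assert (Lip1 : forall s t : R, Rabs (s - t) <= 2 * Rabs (s - t)).
    { intros s t. pose proof (Rabs_pos (s - t)). lra. }
    (* The first half of the side [s = 0] is [g1], so there [Phi] competes with [p1] and uniqueness
       compares the increments. The second half is [g2] reversed, whence [1 - t / 2] below. *)
    assert (E1 : (p1 1 - p1 0 = Phi 0 (1 / 2)%R - Phi 0 0)%C).
    { replace (Phi 0 0) with (Phi 0 (0 / 2)) by (f_equal; field).
      apply (curve_primitive_unique h g1 p1 (fun t => Phi 0 (t / 2)) 0 1);
        [lra | exact K1 | exact P1 |].
      apply (curve_primitive_reparam h _ Phi 0 1 0 1 (fun _ => 0) (fun t => t / 2) _ _ _ _ HPhi).
      - intros t Ht. unfold in_rect; lra.
      - apply Lip0.
      - intros s t. replace (s / 2 - t / 2) with ((s - t) / 2) by field.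
        unfold Rdiv. rewrite Rabs_mult, (Rabs_pos_eq (/ 2)) by lra.
        pose proof (Rabs_pos (s - t)). lra.
      - intros t Ht. rewrite H0 by (split; lra). rewrite L1 by lra. f_equal. field.
      - reflexivity. }
    assert (E2 : (p2 1 - p2 0 = Phi 0 (1 / 2)%R - Phi 0 1)%C).
    { replace (Phi 0 1) with (Phi 0 (1 - 0 / 2)) by (f_equal; field).
      replace (Phi 0 (1 / 2)) with (Phi 0 (1 - 1 / 2)) by (f_equal; field).
      apply (curve_primitive_unique h g2 p2 (fun t => Phi 0 (1 - t / 2)) 0 1);
        [lra | exact K2 | exact P2 |].
      apply (curve_primitive_reparam h _ Phi 0 1 0 1 (fun _ => 0) (fun t => 1 - t / 2) _ _ _ _ HPhi).
      - intros t Ht. unfold in_rect; lra.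
      - apply Lip0.
      - intros s t. replace (1 - s / 2 - (1 - t / 2)) with (- ((s - t) / 2)) by field.
        unfold Rdiv. rewrite Rabs_Ropp, Rabs_mult, (Rabs_pos_eq (/ 2)) by lra.
        pose proof (Rabs_pos (s - t)). lra.
      - intros t Ht. rewrite H0 by (split; lra). rewrite L2 by lra. f_equal. field.
      - reflexivity. }
    (* The remaining three sides are constant, so [Phi] agrees at all four corners; in particular
       [Phi 0 0 = Phi 0 1], which equates the two increments. *)
    assert (B1 : Phi 1 0 = Phi 0 0).
    { apply (primitive_along_const_edge h _ Phi 0 1 0 1 (fun t => t) (fun _ => 0) (loop 0) HPhi);
        auto.
      - intros t Ht. unfold in_rect; lra.
      - intros t Ht. apply Hs. exact Ht. }
    assert (B2 : Phi 1 1 = Phi 0 1).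
    { apply (primitive_along_const_edge h _ Phi 0 1 0 1 (fun t => t) (fun _ => 1) (loop 0) HPhi);
        auto.
      - intros t Ht. unfold in_rect; lra.
      - intros t Ht. apply Hs. exact Ht. }
    assert (B3 : Phi 1 1 = Phi 1 0).
    { apply (primitive_along_const_edge h _ Phi 0 1 0 1 (fun _ => 1) (fun t => t) (loop 0) HPhi);
        auto.
      intros t Ht. unfold in_rect; lra. }
    rewrite E1, E2. congruence.
Qed.

Lemma curve_int_primitive (U : C -> Prop) (h : C -> C) (u x : C) (gamma phi : R -> C) :
  Cdiff_on U h -> curve_in U u x gamma -> curve_primitive h gamma phi 0 1 ->
  curve_int h gamma = (phi 1 - phi 0)%C.
Proof.
  intros Hh (Hg & HgU & _ & _) HP. apply is_CInt_CInt.
  apply curve_primitive_is_CInt; [exact Hg| |exact HP].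
  intros t Ht. apply (Cdiff_on_Ccont U); auto.
Qed.

(** Justifies the [iota] in [path_int]: by path independence every curve gives this value, and the
    presence of [gamma] excludes any other. *)
Lemma path_int_curve_primitive (U : C -> Prop) (h : C -> C) (u x : C) (gamma phi : R -> C) :
  open (T := C_UniformSpace) U -> simply_connected U -> Cdiff_on U h ->
  curve_in U u x gamma -> curve_primitive h gamma phi 0 1 ->
  path_int U h u x = (phi 1 - phi 0)%C.
Proof.
  intros HU Hsc Hh Hg HP.
  assert (Hall : forall g, curve_in U u x g -> curve_int h g = (phi 1 - phi 0)%C).
  { intros g Hg'. pose proof Hg' as (C1 & U1 & _ & _).
    destruct (curve_primitive_exists U h g 0 1) as [p Hp]; auto; [lra| |].
    { apply piecewise_C1_Rcont. exact C1. }
    rewrite (curve_int_primitive U h u x g p) by assumption.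
    now apply (simply_connected_path_independence U h u x g gamma). }
  unfold path_int. apply (iota_unique (V := C_R_CompleteNormedModule)).
  - intros I HI. rewrite <- (HI gamma Hg). now apply Hall.
  - exact Hall.
Qed.

(** * Construction of curves, and path integrals as primitives *)

Lemma C1_on_affine_curve (gamma : R -> C) (a b : R) (v : C) :
  (forall s t, a <= s <= b -> a <= t <= b -> (gamma s - gamma t = RtoC (s - t) * v)%C) ->
  C1_on gamma a b.
Proof.
  intros H. apply C1_on_iff. exists (fun _ => v). split.
  - intros t _ eps Heps. exists 1. split; [lra|]. intros s _ _.
    replace (v - v)%C with (RtoC 0) by ring. now rewrite Cmod_0.
  - intros t Ht. apply Rderiv_affine. auto.
Qed.

(** Doubling the speed frees the second half of the parameter interval for an appended segment. *)
Lemma piecewise_C1_halve (gamma gamma' : R -> C) (a b : R) :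
  piecewise_C1 gamma a b ->
  (forall t, a / 2 <= t <= b / 2 -> gamma' t = gamma (2 * t)) ->
  piecewise_C1 gamma' (a / 2) (b / 2).
Proof.
  induction 1 as [a b Hab HC | a b c H1 IH1 H2 IH2]; intros Heq.
  - apply piecewise_C1_piece; [lra|]. apply C1_on_iff in HC. apply C1_on_iff.
    destruct HC as (dg & Hc & Hd). exists (fun t => 2 * dg (2 * t)%R)%C.
    assert (Hdist : forall s t d, Rabs (s - t) < d / 2 -> Rabs (2 * s - 2 * t) < d).
    { intros s t d Hst. replace (2 * s - 2 * t) with (2 * (s - t)) by ring.
      rewrite Rabs_mult, (Rabs_pos_eq 2) by lra. lra. }
    split.
    + intros t Ht. apply Rcont_const_mul. intros eps Heps.
      destruct (Hc (2 * t) ltac:(lra) eps Heps) as (d & Hd0 & H).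
      exists (d / 2). split; [lra|]. intros s Hs Hst. apply H; [lra|]. now apply Hdist.
    + intros t Ht eps Heps.
      destruct (Hd (2 * t) ltac:(lra) (eps / 2) ltac:(lra)) as (d & Hd0 & H).
      exists (d / 2). split; [lra|]. intros s Hs Hst. rewrite !Heq by lra.
      specialize (H (2 * s) ltac:(lra) (Hdist s t d Hst)).
      replace (RtoC (s - t) * (2 * dg (2 * t)%R))%C with (RtoC (2 * s - 2 * t) * dg (2 * t)%R)%C
        by (rewrite !RtoC_minus, !RtoC_mult; ring).
      eapply Rle_trans; [exact H|]. replace (2 * s - 2 * t) with (2 * (s - t)) by ring.
      rewrite Rabs_mult, (Rabs_pos_eq 2) by lra. lra.
  - pose proof (piecewise_C1_lt _ _ _ H1). pose proof (piecewise_C1_lt _ _ _ H2).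
    apply piecewise_C1_concat with (b / 2); [apply IH1 | apply IH2];
      intros t Ht; apply Heq; lra.
Qed.

Lemma curve_in_const (U : C -> Prop) (u : C) : U u -> curve_in U u u (fun _ => u).
Proof.
  intros Hu. split; [|easy]. apply piecewise_C1_piece; [lra|].
  apply C1_on_affine_curve with (RtoC 0). intros. ring.
Qed.

(** The formulas for both halves are part of the conclusion because a primitive along the extended
    curve is later split at [1 / 2]. *)
Lemma curve_in_extend (U : C -> Prop) (u x y : C) (gamma : R -> C) :
  curve_in U u x gamma -> (forall t, 0 <= t <= 1 -> U (segment x y t)) ->
  exists gamma', curve_in U u y gamma' /\
    (forall t, t <= 1 / 2 -> gamma' t = gamma (2 * t)) /\
    (forall t, 1 / 2 <= t -> gamma' t = segment x y (2 * t - 1)).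
Proof.
  intros (HC & HU & H0 & H1) Hseg.
  set (g := fun t => if Rle_dec t (1 / 2) then gamma (2 * t) else segment x y (2 * t - 1)).
  assert (L1 : forall t, t <= 1 / 2 -> g t = gamma (2 * t)).
  { intros t Ht. unfold g. destruct Rle_dec; [reflexivity | lra]. }
  assert (L2 : forall t, 1 / 2 <= t -> g t = segment x y (2 * t - 1)).
  { intros t Ht. unfold g. destruct Rle_dec; [|reflexivity].
    replace t with (1 / 2) by lra. replace (2 * (1 / 2)) with 1 by field.
    rewrite Rminus_diag, segment_0. exact H1. }
  exists g. split; [|now split]. repeat split.
  - apply piecewise_C1_concat with (1 / 2).
    + replace 0 with (0 / 2) by field.
      apply (piecewise_C1_halve gamma g 0 1 HC). intros t Ht. apply L1; lra.
    + apply piecewise_C1_piece; [lra|]. apply C1_on_affine_curve with (2 * (y - x))%C.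
      intros s t Hs Ht. rewrite !L2 by lra. unfold segment.
      rewrite !RtoC_minus, !RtoC_mult. ring.
  - intros t [Ht0 Ht1]. destruct (Rle_dec t (1 / 2)).
    + rewrite L1 by lra. apply HU. split; lra.
    + rewrite L2 by lra. apply Hseg. lra.
  - rewrite L1 by lra. now rewrite Rmult_0_r.
  - rewrite L2 by lra. replace (2 * 1 - 1) with 1 by ring. apply segment_1.
Qed.

(** The reachable points of [U] and the unreachable ones both form open sets, because any two points
    of a disc in [U] are joined by a segment. The sets are disjoint and cover [U], so connectedness
    leaves no unreachable point. *)
Lemma curve_in_exists (U : C -> Prop) (u x : C) :
  open (T := C_UniformSpace) U -> connected_set U -> U u -> U x ->
  exists gamma, curve_in U u x gamma.
Proof.
  intros HU Hconn Hu Hx.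
  set (A := fun z => U z /\ exists gamma, curve_in U u z gamma).
  set (B := fun z => U z /\ ~ exists gamma, curve_in U u z gamma).
  assert (Hstep : forall z r w, (forall v, Cmod (v - z) < r -> U v) ->
    Cmod (w - z) < r -> forall w', Cmod (w' - z) < r ->
    (exists gamma, curve_in U u w gamma) -> exists gamma, curve_in U u w' gamma).
  { intros z r w Hr Hw w' Hw' [g Hg].
    destruct (curve_in_extend U u w w' g Hg) as (g' & Hg' & _); [|now exists g'].
    intros t Ht. apply Hr. now apply segment_in_ball. }
  assert (Hself : forall z : C, forall r, 0 < r -> Cmod (z - z) < r).
  { intros z r Hr. replace (z - z)%C with (RtoC 0) by ring. now rewrite Cmod_0. }
  destruct (excluded_middle_informative (exists gamma, curve_in U u x gamma)) as [H|H];
    [exact H|exfalso].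
  destruct (Hconn A B) as (z & Hz & [_ HA] & [_ HB]).
  - intros z [Hz HA]. destruct (open_Cball U z HU Hz) as (r & Hr & HrU).
    apply locally_Cmod. exists r. split; [exact Hr|]. intros w Hw. split; [auto|].
    now apply (Hstep z r z HrU (Hself z r Hr) w Hw).
  - intros z [Hz HB]. destruct (open_Cball U z HU Hz) as (r & Hr & HrU).
    apply locally_Cmod. exists r. split; [exact Hr|]. intros w Hw. split; [auto|].
    intros HA. apply HB. now apply (Hstep z r w HrU Hw z (Hself z r Hr)).
  - intros z Hz. unfold A, B. tauto.
  - exists u. split; [exact Hu|]. split; [exact Hu|]. exists (fun _ => u). now apply curve_in_const.
  - exists x. split; [exact Hx|]. split; [exact Hx|exact H].
  - contradiction.
Qed.

Lemma path_int_base (U : C -> Prop) (h : C -> C) (u : C) :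
  open (T := C_UniformSpace) U -> simply_connected U -> Cdiff_on U h -> U u ->
  path_int U h u u = 0.
Proof.
  intros HU Hsc Hh Hu. destruct (Cdiff_on_local_primitive U h u HU Hh Hu) as (F & r & Hr & HF).
  rewrite (path_int_curve_primitive U h u u (fun _ => u) (fun _ => F u)); try assumption.
  - ring.
  - now apply curve_in_const.
  - intros x t _. exists F, r, 1. repeat split; try lra. exact HF.
Qed.

(** Near [x] the path integral equals a local primitive [F] up to a constant: the curve to [y] may
    be chosen as a fixed curve to [x] followed by a segment inside the disc of [F]. *)
Lemma path_int_Cderiv (U : C -> Prop) (h : C -> C) (u x : C) :
  open (T := C_UniformSpace) U -> connected_set U -> simply_connected U -> Cdiff_on U h ->
  U u -> U x -> Cderiv (path_int U h u) x (h x).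
Proof.
  intros HU Hconn Hsc Hh Hu Hx.
  destruct (Cdiff_on_local_primitive U h x HU Hh Hx) as (F & r1 & Hr1 & HF).
  destruct (open_Cball U x HU Hx) as (r2 & Hr2 & HrU).
  destruct (curve_in_exists U u x HU Hconn Hu Hx) as [g Hg].
  set (r := Rmin r1 r2).
  assert (Hr : 0 < r) by now apply Rmin_glb_lt.
  assert (Hrr1 : r <= r1) by apply Rmin_l. assert (Hrr2 : r <= r2) by apply Rmin_r.
  assert (Hself : Cmod (x - x) < r).
  { replace (x - x)%C with (RtoC 0) by ring. now rewrite Cmod_0. }
  assert (Hloc : forall y, Cmod (y - x) < r ->
    path_int U h u y = (F y + (path_int U h u x - F x))%C).
  { intros y Hy. assert (Hseg : forall t, 0 <= t <= 1 -> Cmod (segment x y t - x) < r).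
    { intros t Ht. now apply segment_in_ball. }
    destruct (curve_in_extend U u x y g Hg) as (g' & Hg' & L1 & L2).
    { intros t Ht. apply HrU. specialize (Hseg t Ht). lra. }
    pose proof Hg' as (HC & HgU & _ & Hg1).
    pose proof (piecewise_C1_Rcont _ _ _ HC) as Hcont.
    destruct (curve_primitive_exists U h g' 0 1) as [phi Hphi]; auto; [lra|].
    rewrite (path_int_curve_primitive U h u y g' phi) by assumption.
    rewrite (path_int_curve_primitive U h u x g (fun t => phi (t / 2))); try assumption.
    2:{ apply (curve_primitive_affine h g' phi _ _ 0 1 0 1 (/ 2) 0 Hphi).
        - rewrite Rabs_pos_eq; lra.
        - intros; lra.
        - intros t Ht. rewrite L1 by lra. f_equal. field.
        - intros t Ht. f_equal. field. }
    (* The second half of [g'] stays in the disc, so there [F] composed with [g'] is another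
       primitive along the curve. *)
    assert (E : (phi 1 - phi (1 / 2)%R = F (g' 1) - F (g' (1 / 2)%R))%C).
    { apply (curve_primitive_unique h g' phi (fun t => F (g' t)) (1 / 2) 1); [lra| | |].
      - intros t Ht eps Heps. destruct (Hcont t ltac:(lra) eps Heps) as (d & Hd & H').
        exists d. split; [exact Hd|]. intros s Hs. apply H'. lra.
      - apply (curve_primitive_affine h g' phi _ _ 0 1 _ _ 1 0 Hphi).
        + rewrite Rabs_R1; lra.
        + intros; lra.
        + intros; f_equal; ring.
        + intros; f_equal; ring.
      - intros x' t [_ Ht].
        assert (Hin : Cmod (g' t - x) < r) by (rewrite L2 by lra; apply Hseg; lra).
        exists F, (r - Cmod (g' t - x)), 1. repeat split; try lra.
        intros w Hw. apply HF. pose proof (Cmod_sub_triangle w (g' t) x). lra. }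
    rewrite Hg1, L2 in E by lra. replace (2 * (1 / 2) - 1) with 0 in E by field.
    rewrite segment_0 in E. replace (0 / 2) with 0 by field.
    replace (phi 1 - phi 0)%C with ((phi 1 - phi (1 / 2)%R) + (phi (1 / 2)%R - phi 0))%C by ring.
    rewrite E. ring. }
  intros eps Heps.
  destruct (Cderiv_add_const F x (h x) (path_int U h u x - F x)%C
    (HF x ltac:(lra)) eps Heps) as (d & Hd & H').
  exists (Rmin d r). split; [now apply Rmin_glb_lt|]. intros w Hw.
  rewrite (Hloc w) by (eapply Rlt_le_trans; [exact Hw | apply Rmin_r]).
  specialize (H' w (Rlt_le_trans _ _ _ Hw (Rmin_l _ _))).
  now replace (F x + (path_int U h u x - F x))%C with (path_int U h u x) in H' by ring.
Qed.

(** * Growth along a curve in terms of arc length *)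

Definition arc_length (gamma : R -> C) (t : R) : R :=
  RInt (fun s => Cmod (velocity gamma s)) 0 t.

Lemma Rcont_Cmod_continuous (f : R -> C) (t : R) :
  Rcont (fun _ => True) f t -> continuous (fun s => Cmod (f s)) t.
Proof.
  intros H P [e HP]. destruct (H e (cond_pos e)) as (d & Hd & H').
  exists (mkposreal d Hd). intros s Hs. apply HP.
  specialize (H' s I Hs).
  change (Rabs (Cmod (f s) - Cmod (f t)) < e).
  pose proof (Cmod_triangle (f s - f t) (f t)) as T1.
  pose proof (Cmod_triangle (f t - f s) (f s)) as T2.
  replace (f s - f t + f t)%C with (f s) in T1 by ring.
  replace (f t - f s + f s)%C with (f t) in T2 by ring.
  rewrite (Cmod_sub_sym (f t)) in T2. apply Rabs_lt_between. lra.
Qed.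

(** Replaces the speed, unreliable at the ends of the piece, by a function continuous on the whole
    line that agrees with it inside. *)
Lemma is_RInt_speed_piece (gamma dg : R -> C) (a b t : R) :
  (forall t, a <= t <= b -> Rcont (fun s => a <= s <= b) dg t) ->
  (forall t, a <= t <= b -> Rderiv (fun s => a <= s <= b) gamma t (dg t)) ->
  a <= t <= b ->
  is_RInt (fun s => Cmod (velocity gamma s)) a t
    (RInt (fun s => Cmod (dg (clamp a b s))) a t).
Proof.
  intros Hc Hd Ht.
  apply (is_RInt_ext (fun s => Cmod (dg (clamp a b s)))).
  { intros s. rewrite Rmin_left, Rmax_right by lra. intros Hs.
    rewrite clamp_id by lra. f_equal. symmetry. apply (velocity_eq gamma a b); [lra|].
    apply Hd; lra. }
  apply (RInt_correct (V := R_CompleteNormedModule)).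
  apply (ex_RInt_continuous (V := R_CompleteNormedModule)). intros s _.
  apply (Rcont_Cmod_continuous (fun s => dg (clamp a b s))). apply Rcont_clamp; [lra | exact Hc].
Qed.

Lemma ex_RInt_speed (gamma : R -> C) (a b : R) :
  piecewise_C1 gamma a b -> ex_RInt (fun s => Cmod (velocity gamma s)) a b.
Proof.
  induction 1 as [a b Hab HC | a b c H1 IH1 H2 IH2].
  - apply C1_on_iff in HC. destruct HC as (dg & Hc & Hd).
    eexists. apply (is_RInt_speed_piece gamma dg a b b Hc Hd). lra.
  - now apply ex_RInt_Chasles with b.
Qed.

(* On each C^1 piece the arc length [L] satisfies [(L^(k+1)/(k+1)!)' = L^k/k! |gamma'|]. *)
Lemma increment_bound (U : C -> Prop) (u x : C) (G w : C -> C) (gamma : R -> C) (K : R) (k : nat) :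
  (forall z, U z -> Cderiv G z (w z)) -> (forall z, U z -> Ccont w z) ->
  curve_in U u x gamma ->
  (forall t, 0 <= t <= 1 -> Cmod (w (gamma t)) <= K * (arc_length gamma t ^ k / INR (fact k))) ->
  forall a b, piecewise_C1 gamma a b -> 0 <= a -> b <= 1 ->
  forall s t, a <= s -> s <= t -> t <= b ->
  Cmod (G (gamma t) - G (gamma s)) <=
    K * (arc_length gamma t ^ S k / INR (fact (S k)))
    - K * (arc_length gamma s ^ S k / INR (fact (S k))).
Proof.
  intros HG Hw (HC01 & HgU & _) Hb a b.
  induction 1 as [a b Hab HC | a b c H1 IH1 H2 IH2]; intros Ha0 Hb1 s t Hs Hst Ht.
  - apply C1_on_iff in HC. destruct HC as (dg & Hc & Hd).
    set (sp := fun s => Cmod (dg (clamp a b s))).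
    (* [L] continues the arc length beyond the piece as a function differentiable everywhere, with
       derivative [sp]. *)
    set (L := fun t => plus (arc_length gamma a) (RInt sp a t)).
    assert (Hsp : forall t, continuous sp t).
    { intros y. apply (Rcont_Cmod_continuous (fun s => dg (clamp a b s))).
      apply Rcont_clamp; [lra | exact Hc]. }
    assert (HL : forall t, a <= t <= b -> arc_length gamma t = L t).
    { intros y Hy. apply (is_RInt_unique (V := R_CompleteNormedModule)).
      apply (is_RInt_Chasles (V := R_NormedModule)) with a.
      - apply (RInt_correct (V := R_CompleteNormedModule)).
        apply (ex_RInt_Chasles_1 (V := R_CompleteNormedModule)) with 1; [lra|].
        now apply ex_RInt_speed.
      - now apply is_RInt_speed_piece. }
    assert (HdL : forall t, is_derive L t (sp t)).
    { intros y. unfold L. rewrite <- (plus_zero_l (sp y)).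
      apply (is_derive_plus (V := R_NormedModule)); [apply (is_derive_const (V := R_NormedModule))|].
      apply (is_derive_RInt (V := R_NormedModule) sp _ a).
      - apply filter_forall. intros z. apply (RInt_correct (V := R_CompleteNormedModule)).
        apply (ex_RInt_continuous (V := R_CompleteNormedModule)). auto.
      - apply Hsp. }
    rewrite !HL by lra.
    assert (Hre : forall c z : R, K * / c * z = K * (z / c)) by (intros; unfold Rdiv; ring).
    set (B := fun t => K * (L t ^ S k / INR (fact (S k)))).
    change (Cmod (G (gamma t) - G (gamma s)) <= B t - B s).
    (* Both sides are increments of primitives, so the claim reduces to a pointwise comparison of
       the integrands: [w (gamma y) * dg y] against its bound times the speed. *)
    rewrite Cmod_norm.
    apply (norm_RInt_le (V := C_R_NormedModule) (fun y => w (gamma y) * dg y)%C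
      (fun y => K * (L y ^ k / INR (fact k)) * sp y) s t); [exact Hst| | |].
    + intros y Hy. rewrite <- Cmod_norm, Cmod_mult. unfold sp. rewrite clamp_id by lra.
      apply Rmult_le_compat_r; [apply Cmod_ge_0|]. rewrite <- HL by lra. apply Hb; lra.
    + apply (is_CInt_derive_within (fun y => G (gamma y)) (fun y => w (gamma y) * dg y)%C a b);
        [lra..| |].
      * intros y Hy. assert (HUy : U (gamma y)) by (apply HgU; split; lra).
        apply Rcont_mul; [|auto]. apply Ccont_comp_curve; [auto|].
        now apply Rderiv_Rcont with (dg y), Hd.
      * intros y Hy. assert (HUy : U (gamma y)) by (apply HgU; split; lra).
        apply Cderiv_comp_curve; auto.
    + apply (is_RInt_derive (V := R_CompleteNormedModule) B).
      * intros y _. unfold B.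
        replace (K * (L y ^ k / INR (fact k)) * sp y)
          with (K * / INR (fact (S k)) * (INR (S k) * sp y * L y ^ pred (S k))).
        { apply (is_derive_ext (fun t => K * / INR (fact (S k)) * L t ^ S k)).
          { intros z. apply Hre. }
          apply (is_derive_scal (fun t => L t ^ S k)). now apply is_derive_pow. }
        simpl pred. rewrite fact_simpl, mult_INR.
        match goal with |- ?e1 = ?e2 => change (@eq R e1 e2) end. field.
        split; [apply INR_fact_neq_0 | apply not_0_INR; lia].
      * intros y _. apply (continuous_mult (K := R_AbsRing)); [|apply Hsp].
        apply (ex_derive_continuous (V := R_NormedModule)).
        exists (K * / INR (fact k) * (INR k * sp y * L y ^ pred k)).
        apply (is_derive_ext (fun t => K * / INR (fact k) * L t ^ k)).
        { intros z. apply Hre. }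
        apply (is_derive_scal (fun t => L t ^ k)). now apply is_derive_pow.
  - pose proof (piecewise_C1_lt _ _ _ H1). pose proof (piecewise_C1_lt _ _ _ H2).
    destruct (Rle_dec t b) as [Htb|Htb]; [apply IH1; lra|].
    destruct (Rle_dec b s) as [Hbs|Hbs]; [apply IH2; lra|].
    specialize (IH1 ltac:(lra) ltac:(lra) s b ltac:(lra) ltac:(lra) ltac:(lra)).
    specialize (IH2 ltac:(lra) ltac:(lra) b t ltac:(lra) ltac:(lra) ltac:(lra)).
    pose proof (Cmod_sub_triangle (G (gamma t)) (G (gamma b)) (G (gamma s))). lra.
Qed.

Lemma arc_length_0 (gamma : R -> C) : arc_length gamma 0 = 0.
Proof. apply (RInt_point (V := R_CompleteNormedModule)). Qed.

(** At parameter 0 both [G] and the arc length vanish, so the increment bound becomes a bound for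
    [G] itself. The exponent [S k] is positive, so no [0 ^ 0] arises. *)
Lemma growth_bound (U : C -> Prop) (u x : C) (G w : C -> C) (gamma : R -> C) (K : R) (k : nat) :
  (forall z, U z -> Cderiv G z (w z)) -> (forall z, U z -> Ccont w z) -> G u = 0 ->
  curve_in U u x gamma ->
  (forall t, 0 <= t <= 1 -> Cmod (w (gamma t)) <= K * (arc_length gamma t ^ k / INR (fact k))) ->
  forall t, 0 <= t <= 1 ->
  Cmod (G (gamma t)) <= K * (arc_length gamma t ^ S k / INR (fact (S k))).
Proof.
  intros HG Hw Gu Hg Hb t Ht.
  pose proof (increment_bound U u x G w gamma K k HG Hw Hg Hb 0 1 (proj1 Hg)
    ltac:(lra) ltac:(lra) 0 t ltac:(lra) ltac:(lra) ltac:(lra)) as H.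
  destruct Hg as (_ & _ & H0 & _). rewrite H0, Gu, arc_length_0 in H.
  rewrite pow_i in H by lia.
  replace (G (gamma t) - 0)%C with (G (gamma t)) in H by ring. lra.
Qed.

(** The mean value theorem fails for complex values, so it is applied to the real part of [c * f]
    along the segment, [c] being the conjugate of [f y - f z]. The increment of that real part is
    the squared modulus of [f y - f z]; one factor is then cancelled. *)
Lemma lipschitz_of_Cderiv_bound (V : C -> Prop) (f df : C -> C) (M : R) :
  convex_set V -> (forall z, V z -> Cderiv f z (df z)) -> (forall z, V z -> Cmod (df z) <= M) ->
  forall y z, V y -> V z -> Cmod (f y - f z) <= M * Cmod (y - z).
Proof.
  intros Hconv Hd HM y z Hy Hz.
  set (c := Cconj (f y - f z)).
  assert (Hseg : forall t, 0 <= t <= 1 -> V (segment z y t)).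
  { intros t Ht. replace (segment z y t) with (RtoC (1 - t) * z + RtoC t * y)%C.
    - now apply Hconv.
    - unfold segment. rewrite RtoC_minus. ring. }
  set (p := fun t => fst (c * f (segment z y t))%C).
  assert (Hp : forall t, 0 <= t <= 1 -> is_derive p t (fst (c * (df (segment z y t) * (y - z)))%C)).
  { intros t Ht. apply (Rderiv_coord fst (fun t => c * f (segment z y t))%C).
    - intros; simpl; ring.
    - intros; simpl; ring.
    - exact Rabs_fst_le.
    - apply (Cderiv_comp_curve (fun v => c * v)%C).
      + intros eps Heps. exists 1. split; [lra|]. intros v _.
        replace (_ - _)%C with (RtoC 0) by ring. rewrite Cmod_0.
        apply Rmult_le_pos; [lra | apply Cmod_ge_0].
      + apply (Cderiv_comp_curve f); [auto | apply Rderiv_segment]. }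
  destruct (MVT_gen p 0 1 (fun t => fst (c * (df (segment z y t) * (y - z)))%C)) as (t & Ht & E).
  - rewrite Rmin_left, Rmax_right by lra. intros t Ht. apply Hp; lra.
  - rewrite Rmin_left, Rmax_right by lra. intros t Ht.
    apply continuity_pt_filterlim, (ex_derive_continuous (V := R_NormedModule)).
    eexists. apply Hp; lra.
  - rewrite Rmin_left, Rmax_right in Ht by lra.
    unfold p in E. rewrite segment_0, segment_1, Rminus_0_r, Rmult_1_r in E.
    set (D := Cmod (f y - f z)). assert (HD : 0 <= D) by apply Cmod_ge_0.
    assert (E2 : fst (c * f y)%C - fst (c * f z)%C = D * D).
    { unfold D. replace (Cmod (f y - f z) * Cmod (f y - f z)) with (Cmod (f y - f z) ^ 2) by ring.
      rewrite Cmod2_alt. unfold c, Re, Im, Cconj. simpl. ring. }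
    rewrite E2 in E.
    assert (Hle : D * D <= D * (M * Cmod (y - z))).
    { rewrite E. eapply Rle_trans; [apply Rle_abs|]. eapply Rle_trans; [apply Rabs_fst_le|].
      rewrite !Cmod_mult. unfold c at 1. rewrite Cmod_conj. fold D.
      apply Rmult_le_compat_l; [exact HD|]. apply Rmult_le_compat_r; [apply Cmod_ge_0|]. auto. }
    destruct (Req_dec D 0) as [H0|H0].
    + rewrite H0. apply Rmult_le_pos; [|apply Cmod_ge_0].
      eapply Rle_trans; [apply Cmod_ge_0 | apply (HM z Hz)].
    + apply Rmult_le_reg_l with D; lra.
Qed.

(** * Approximation systems *)

(** The infimum need not be attained; continuity of the right-hand side in the length carries the
    bound over. If the bound failed at the infimum, it would fail for some curve of nearly minimal
    length. *)
Lemma inner_dist_limit (U : C -> Prop) (u x : C) (E K c : R) (q : nat) :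
  (exists gamma, curve_in U u x gamma) ->
  (forall gamma, curve_in U u x gamma -> E <= K * (curve_length gamma ^ q / c)) ->
  E <= K * (inner_dist U u x ^ q / c).
Proof.
  intros [g0 Hg0] HE. unfold inner_dist.
  set (S := fun L => exists gamma, curve_in U u x gamma /\ L = curve_length gamma).
  destruct (Glb_Rbar_correct S) as [Hlb Hglb].
  (* Lengths are nonnegative and [g0] provides one of them, so the infimum is finite and [real]
     returns it unchanged. *)
  assert (H0 : Rbar_le 0 (Glb_Rbar S)).
  { apply Hglb. intros L (g & (HC & _) & ->). apply RInt_ge_0; [lra| |].
    - now apply ex_RInt_speed.
    - intros t _. apply Cmod_ge_0. }
  assert (H1 := Hlb _ (ex_intro _ g0 (conj Hg0 eq_refl))).
  destruct (Glb_Rbar S) as [d| |]; try contradiction. simpl.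
  destruct (Rle_lt_dec E (K * (d ^ q / c))) as [H|H]; [exact H|exfalso].
  set (p := fun L => K * (L ^ q / c)).
  assert (Hp : continuous p d).
  { apply (ex_derive_continuous (V := R_NormedModule)). unfold p.
    apply ex_derive_scal. unfold Rdiv. apply (ex_derive_mult (fun L => L ^ q) (fun _ => / c)).
    - apply ex_derive_pow. apply ex_derive_id.
    - apply ex_derive_const. }
  destruct (proj1 (locally_R_iff _ d) (Hp (fun y => y < E) (open_lt E (p d) H)))
    as (e & He & H').
  assert (Hnear : exists L, S L /\ L < d + e).
  { destruct (excluded_middle_informative (exists L, S L /\ L < d + e)) as [Hex|Hex]; [exact Hex|].
    exfalso. assert (Hd : Rbar_le (d + e) d).
    { apply Hglb. intros L HL. simpl. destruct (Rle_lt_dec (d + e) L) as [Hle|Hlt]; [exact Hle|].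
      exfalso. apply Hex. now exists L. }
    simpl in Hd. lra. }
  destruct Hnear as (L & HL & HLe). pose proof (Hlb L HL) as HdL. simpl in HdL.
  assert (HpL : p L < E) by (apply H'; apply Rabs_lt_between; lra).
  destruct HL as (g & Hg & ->). specialize (HE g Hg). unfold p in HpL. lra.
Qed.

(** Finiteness matters because [real] would turn an infinite supremum into 0. *)
Lemma supnorm_bound {T : Type} (Y : T -> Prop) (F : T -> C) (p : T) :
  is_finite (supnorm Y F) -> Y p -> Cmod (F p) <= real (supnorm Y F).
Proof.
  intros Hfin Hp. unfold supnorm in *.
  destruct (Lub_Rbar_correct (fun s => exists p, Y p /\ s = Cmod (F p))) as [Hub _].
  specialize (Hub _ (ex_intro _ p (conj Hp eq_refl))). rewrite <- Hfin in Hub. exact Hub.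
Qed.

(** By complex linearity the differential is determined by its values [l1] and [l2] on the two basis
    vectors. The product norm is Euclidean, hence at most the sum of the two moduli. *)
Lemma holomorphic2_expansion (Y : C * C -> Prop) (F : C * C -> C) (x y : C) :
  holomorphic2_on Y F -> Y (x, y) ->
  exists l1 l2, forall eps, 0 < eps -> exists d, 0 < d /\
    forall z w, Cmod (z - x) < d -> Cmod (w - y) < d ->
    Cmod (F (z, w) - F (x, y) - ((z - x) * l1 + (w - y) * l2))
      <= eps * (Cmod (z - x) + Cmod (w - y)).
Proof.
  intros HF HY. destruct (HF (x, y) HY) as (l & Hlin & Hl).
  exists (l (RtoC 1, RtoC 0)), (l (RtoC 0, RtoC 1)). intros eps Heps.
  specialize (Hl (x, y) (fun P HP => HP) (mkposreal eps Heps)).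
  destruct Hl as [d Hd].
  destruct (proj1 (locally_Cmod (ball (M := C_UniformSpace) x d) x)
    (locally_ball (T := C_UniformSpace) x d)) as (d1 & Hd1 & H1).
  destruct (proj1 (locally_Cmod (ball (M := C_UniformSpace) y d) y)
    (locally_ball (T := C_UniformSpace) y d)) as (d2 & Hd2 & H2).
  exists (Rmin d1 d2). split; [now apply Rmin_glb_lt|]. intros z w Hz Hw.
  specialize (Hd (z, w) (conj (H1 z (Rlt_le_trans _ _ _ Hz (Rmin_l _ _)))
    (H2 w (Rlt_le_trans _ _ _ Hw (Rmin_r _ _))))).
  pose (CC := prod_NormedModule C_AbsRing C_NormedModule C_NormedModule).
  assert (El : l (minus (G := CC) (z, w) (x, y))
    = ((z - x) * l (RtoC 1, RtoC 0) + (w - y) * l (RtoC 0, RtoC 1))%C).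
  { destruct Hlin as [Hadd Hscal _].
    replace (minus (G := CC) (z, w) (x, y)) with
      (plus (G := CC) (scal (V := CC) (z - x)%C (RtoC 1, RtoC 0))
        (scal (V := CC) (w - y)%C (RtoC 0, RtoC 1))).
    - rewrite Hadd, !Hscal. reflexivity.
    - apply injective_projections.
      + change ((z - x) * 1 + (w - y) * 0 = z - x)%C. ring.
      + change ((z - x) * 0 + (w - y) * 1 = w - y)%C. ring. }
  change (Cmod (F (z, w) - F (x, y) - l (minus (G := CC) (z, w) (x, y)))
    <= eps * sqrt (Cmod (z - x) ^ 2 + Cmod (w - y) ^ 2)) in Hd.
  rewrite El in Hd. eapply Rle_trans; [exact Hd|]. apply Rmult_le_compat_l; [lra|].
  pose proof (Cmod_ge_0 (z - x)). pose proof (Cmod_ge_0 (w - y)).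
  rewrite <- (sqrt_pow2 (Cmod (z - x) + Cmod (w - y))) by lra.
  apply sqrt_le_1_alt. nra.
Qed.

Lemma holomorphic2_comp (Y : C * C -> Prop) (F : C * C -> C) (h : C -> C) (x : C) :
  holomorphic2_on Y F -> Y (x, h x) -> (exists l, Cderiv h x l) ->
  exists l, Cderiv (fun t => F (t, h t)) x l.
Proof.
  intros HF HY [l Hl].
  destruct (holomorphic2_expansion Y F x (h x) HF HY) as (l1 & l2 & H).
  exists (l1 + l * l2)%C. intros eps Heps.
  pose proof (Cmod_ge_0 l) as Hl0. pose proof (Cmod_ge_0 l2) as Hl20.
  (* [e2 <= 1] gives [h] the local Lipschitz constant [Cmod l + 1], so the joint increment is at
     most [Cmod l + 2] times [Cmod (w - x)]. Each of the two errors then receives half of [eps]. *)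
  set (e1 := eps / (2 * (Cmod l + 2))). set (e2 := Rmin 1 (eps / (2 * (Cmod l2 + 1)))).
  assert (He1 : 0 < e1) by (apply Rdiv_lt_0_compat; lra).
  assert (He2 : 0 < e2) by (apply Rmin_glb_lt; [lra | apply Rdiv_lt_0_compat; lra]).
  destruct (H e1 He1) as (d1 & Hd1 & H1).
  destruct (Hl e2 He2) as (d2 & Hd2 & H2).
  destruct (Cderiv_Ccont h x l Hl d1 Hd1) as (d3 & Hd3 & H3).
  exists (Rmin (Rmin d1 d2) d3). split; [repeat apply Rmin_glb_lt; assumption|].
  intros w Hw. pose proof (Rmin_l (Rmin d1 d2) d3). pose proof (Rmin_r (Rmin d1 d2) d3).
  pose proof (Rmin_l d1 d2). pose proof (Rmin_r d1 d2).
  specialize (H1 w (h w) ltac:(lra) (H3 w ltac:(lra))). specialize (H2 w ltac:(lra)).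
  pose proof (Cmod_ge_0 (w - x)) as Hwx.
  assert (He21 : e2 <= 1) by apply Rmin_l.
  assert (Hh : Cmod (h w - h x) <= (Cmod l + 1) * Cmod (w - x)).
  { replace (h w - h x)%C with ((h w - h x - (w - x) * l) + (w - x) * l)%C by ring.
    eapply Rle_trans; [apply Cmod_triangle|]. rewrite Cmod_mult. nra. }
  replace (_ - _)%C with
    ((F (w, h w) - F (x, h x) - ((w - x) * l1 + (h w - h x) * l2))
     + (h w - h x - (w - x) * l) * l2)%C by ring.
  eapply Rle_trans; [apply Cmod_triangle|]. rewrite Cmod_mult.
  assert (E1 : e1 * (Cmod (w - x) + Cmod (h w - h x)) <= eps / 2 * Cmod (w - x)).
  { apply Rle_trans with (e1 * ((Cmod l + 2) * Cmod (w - x))).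
    - apply Rmult_le_compat_l; lra.
    - right. unfold e1. field. lra. }
  assert (E2 : Cmod (h w - h x - (w - x) * l) * Cmod l2 <= eps / 2 * Cmod (w - x)).
  { apply Rle_trans with (eps / (2 * (Cmod l2 + 1)) * Cmod (w - x) * (Cmod l2 + 1)).
    - apply Rmult_le_compat; try lra; [apply Cmod_ge_0|].
      eapply Rle_trans; [exact H2|]. apply Rmult_le_compat_r; [lra | apply Rmin_r].
    - right. field. lra. }
  lra.
Qed.

(** [D2] is defined through the total [C_derive]; on [Y] the derivative exists, so the value is the
    true one. *)
Lemma holomorphic2_D2 (Y : C * C -> Prop) (F : C * C -> C) (x y : C) :
  holomorphic2_on Y F -> Y (x, y) -> Cderiv (fun z => F (x, z)) y (D2 F (x, y)).
Proof.
  intros HF HY. destruct (holomorphic2_expansion Y F x y HF HY) as (l1 & l2 & H).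
  assert (Hd : Cderiv (fun z => F (x, z)) y l2).
  { intros eps Heps. destruct (H eps Heps) as (d & Hd & H'). exists d. split; [exact Hd|].
    intros w Hw. assert (Hx0 : Cmod (x - x) = 0).
    { replace (x - x)%C with (RtoC 0) by ring. apply Cmod_0. }
    specialize (H' x w ltac:(lra) Hw). rewrite Hx0, Rplus_0_l in H'.
    now replace ((x - x) * l1 + (w - y) * l2)%C with ((w - y) * l2)%C in H' by ring. }
  unfold D2. simpl fst. simpl snd.
  rewrite (is_C_derive_unique (fun z => F (x, z)) y l2); [exact Hd|].
  now apply is_derive_Cderiv.
Qed.

(** * Derivatives and errors of the approximations *)

Lemma lt_order_of_le (i n : nat) (r : option nat) : (i < n)%nat -> le_order n r -> lt_order i r.
Proof. destruct r; simpl; [lia | auto]. Qed.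

Lemma le_order_of_le (i n : nat) (r : option nat) : (i <= n)%nat -> le_order n r -> le_order i r.
Proof. destruct r; simpl; [lia | auto]. Qed.

Lemma proper_approx_steps_in_V (A : approximation_system) (n k i : nat) (x : C) :
  proper_for_order A n -> (i + S k = n)%nat -> as_U A x ->
  as_V A i (approx_steps A k (S i) x).
Proof.
  intros HP Hik Hx. specialize (HP i ltac:(lia) x Hx). unfold approx_stage in HP.
  now replace (n - S i)%nat with k in HP by lia.
Qed.

Lemma as_f_comp_Cdiff (A : approximation_system) (i : nat) (q : C -> C) :
  lt_order i (as_order A) -> Cdiff_on (as_U A) q -> (forall z, as_U A z -> as_V A i (q z)) ->
  Cdiff_on (as_U A) (fun t => as_f A i (t, q t)).
Proof.
  intros Hi Hq HqV z Hz. apply (holomorphic2_comp (as_Y A i)); auto.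
  - now apply as_f_holomorphic.
  - split; [exact Hz | now apply HqV].
Qed.

Lemma AS_component_Cdiff (A : approximation_system) (g : nat -> C -> C) (i : nat) :
  is_AS_for A g -> lt_order i (as_order A) -> Cdiff_on (as_U A) (g (S i)).
Proof.
  intros (Hghol & _) Hi z Hz. destruct (Hghol (S i)) with (x := z) as [l Hl]; [|exact Hz|].
  (* For finite order [lt_order i] unfolds to [le_order (S i)]. *)
  - destruct (as_order A); exact Hi.
  - exists l. now apply is_derive_Cderiv.
Qed.

Lemma approx_steps_S (A : approximation_system) (n k i : nat) :
  le_order n (as_order A) -> proper_for_order A n -> (i + S k = n)%nat ->
  Cdiff_on (as_U A) (approx_steps A k (S i)) ->
  (forall x, as_U A x ->
    Cderiv (approx_steps A (S k) i) x (as_f A i (x, approx_steps A k (S i) x)))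
  /\ approx_steps A (S k) i (as_u A) = as_a A i.
Proof.
  intros Hn HP Hik Hk.
  assert (Hd : Cdiff_on (as_U A) (fun t => as_f A i (t, approx_steps A k (S i) t))).
  { apply as_f_comp_Cdiff; [|exact Hk|].
    - apply lt_order_of_le with n; [lia | exact Hn].
    - intros x Hx. now apply (proper_approx_steps_in_V A n). }
  split.
  - intros x Hx. simpl. intros eps Heps.
    destruct (path_int_Cderiv (as_U A) _ (as_u A) x (as_U_open A) (as_U_connected A)
      (as_U_simply_connected A) Hd (as_u_in_U A) Hx eps Heps) as (d & Hd0 & H).
    exists d. split; [exact Hd0|]. intros w Hw. specialize (H w Hw).
    match goal with |- Cmod (?a + ?p - (?a + ?q) - ?r) <= _ =>
      replace (a + p - (a + q) - r)%C with (p - q - r)%C by ring end.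
    exact H.
  - simpl. rewrite path_int_base; [ring | | | exact Hd | ].
    + apply as_U_open.
    + apply as_U_simply_connected.
    + apply as_u_in_U.
Qed.

(** The induction is on [k] with [i] free, because step [S k] at [i] integrates step [k] at
    [S i]. *)
Lemma approx_steps_Cdiff (A : approximation_system) (n k i : nat) :
  le_order n (as_order A) -> proper_for_order A n -> (i + k = n)%nat ->
  Cdiff_on (as_U A) (approx_steps A k i).
Proof.
  intros Hn HP. revert i. induction k; intros i Hik x Hx.
  - exists (RtoC 0). intros eps Heps. exists 1. split; [lra|]. intros w _. simpl.
    replace (_ - _)%C with (RtoC 0) by ring. rewrite Cmod_0.
    apply Rmult_le_pos; [lra | apply Cmod_ge_0].
  - destruct (approx_steps_S A n k i Hn HP Hik (IHk (S i) ltac:(lia))) as [H _].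
    eexists. now apply H.
Qed.

(** The curve is fixed throughout and the bound is claimed at all of its parameters, so that the
    bound for [S i] can be integrated along the same curve to give the one for [i]. *)
Lemma approx_error_along_curve (A : approximation_system) (g : nat -> C -> C)
    (n m : nat) (M : nat -> R) (N : R) (x : C) (gamma : R -> C) :
  is_AS_for A g ->
  (forall i, lt_order i (as_order A) -> convex_set (as_V A i)) ->
  le_order n (as_order A) -> proper_for_order A n ->
  (forall i p, (i < n)%nat -> as_Y A i p -> Cmod (D2 (as_f A i) p) <= M i) ->
  curve_in (as_U A) (as_u A) x gamma ->
  (forall t, 0 <= t <= 1 ->
    Cmod (g n (gamma t) - as_a A n) <= N * (arc_length gamma t ^ m / INR (fact m))) ->
  forall k i, (i + k = n)%nat -> forall t, 0 <= t <= 1 ->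
  Cmod (g i (gamma t) - approx_steps A k i (gamma t)) <=
    fold_right Rmult 1 (map M (seq i k)) * N
    * (arc_length gamma t ^ (k + m) / INR (fact (k + m))).
Proof.
  intros HA Hconv Hn HP HM Hg Hbase. pose proof HA as (_ & HgV & Hgu & Hgd).
  pose proof Hg as (_ & HgU & _).
  induction k; intros i Hik t Ht.
  - replace i with n by lia. simpl. rewrite Rmult_1_l. now apply Hbase.
  - assert (Hi : lt_order i (as_order A)) by (apply lt_order_of_le with n; [lia | exact Hn]).
    assert (HUu := as_u_in_U A).
    (* The bound [M i] is nonnegative because [Y_i] contains the point (u, a_{i+1}). *)
    assert (HM0 : 0 <= M i).
    { eapply Rle_trans; [apply Cmod_ge_0|]. apply (HM i (as_u A, as_a A (S i))); [lia|].
      split; [exact HUu | now apply as_a_in_V]. }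
    pose proof (approx_steps_Cdiff A n k (S i) Hn HP ltac:(lia)) as Hdk.
    destruct (approx_steps_S A n k i Hn HP Hik Hdk) as [Hd1 Hu1].
    set (q := approx_steps A k (S i)) in *.
    pose proof (AS_component_Cdiff A g i HA Hi) as Hdg.
    assert (HqV : forall z, as_U A z -> as_V A i (q z)).
    { intros z Hz. now apply (proper_approx_steps_in_V A n). }
    apply (growth_bound (as_U A) (as_u A) x
      (fun z => g i z - approx_steps A (S k) i z)%C
      (fun z => as_f A i (z, g (S i) z) - as_f A i (z, q z))%C gamma
      (fold_right Rmult 1 (map M (seq i (S k))) * N) (k + m)); [| | |exact Hg| |exact Ht].
    + intros z Hz. apply Cderiv_minus; [|now apply Hd1].
      apply is_derive_Cderiv. now apply Hgd.
    + intros z Hz.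
      destruct (as_f_comp_Cdiff A i (g (S i)) Hi Hdg (HgV i Hi) z Hz) as [l1 Hl1].
      destruct (as_f_comp_Cdiff A i q Hi Hdk HqV z Hz) as [l2 Hl2].
      apply Cderiv_Ccont with (l1 - l2)%C.
      apply (Cderiv_minus (fun t => as_f A i (t, g (S i) t)) (fun t => as_f A i (t, q t)));
        assumption.
    + rewrite Hu1, Hgu; [ring|]. apply le_order_of_le with n; [lia | exact Hn].
    + intros s Hs. specialize (IHk (S i) ltac:(lia) s Hs). fold q in IHk.
      assert (HUs : as_U A (gamma s)) by (apply HgU; exact Hs).
      eapply Rle_trans.
      { apply (lipschitz_of_Cderiv_bound (as_V A i) (fun y => as_f A i (gamma s, y))
          (fun y => D2 (as_f A i) (gamma s, y)) (M i)).
        - auto.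
        - intros z Hz. apply (holomorphic2_D2 (as_Y A i)); [now apply as_f_holomorphic|].
          now split.
        - intros z Hz. apply HM; [lia|]. now split.
        - now apply HgV.
        - now apply HqV. }
      (* [seq i (S k)] starts with [i]: the factor [M i] splits off and the rest is the product in
         [IHk]. *)
      simpl. rewrite !Rmult_assoc in *. now apply Rmult_le_compat_l.
Qed.

Lemma approx_error_bound (A : approximation_system) (g : nat -> C -> C)
    (n m : nat) (N : R) (x : C) :
  is_AS_for A g ->
  (forall i, lt_order i (as_order A) -> convex_set (as_V A i)) ->
  le_order n (as_order A) -> proper_for_order A n ->
  (forall i, (i < n)%nat -> is_finite (supnorm (as_Y A i) (D2 (as_f A i)))) ->
  (forall gamma, curve_in (as_U A) (as_u A) x gamma -> forall t, 0 <= t <= 1 ->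
    Cmod (g n (gamma t) - as_a A n) <= N * (arc_length gamma t ^ m / INR (fact m))) ->
  as_U A x ->
  Cmod (g 0%nat x - approx A n x) <=
    prod_below (fun i => real (supnorm (as_Y A i) (D2 (as_f A i)))) n * N
    * (inner_dist (as_U A) (as_u A) x ^ (n + m) / INR (fact (n + m))).
Proof.
  intros HA Hconv Hn HP HfM Hbase Hx. apply inner_dist_limit.
  - apply curve_in_exists; [apply as_U_open | apply as_U_connected | apply as_u_in_U | exact Hx].
  - intros gamma Hg. pose proof Hg as (_ & _ & _ & Hg1).
    (* The error at [x] is read at parameter 1, where [arc_length] is by definition the
       [curve_length]. *)
    rewrite <- Hg1 at 1 2. unfold approx, approx_stage. rewrite Nat.sub_0_r.
    apply (approx_error_along_curve A g n m
      (fun i => real (supnorm (as_Y A i) (D2 (as_f A i)))) N x gamma); auto; [|lra].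
    intros i p Hi Hp. apply supnorm_bound; auto.
Qed.

Theorem theorem4p2 :
  forall (A : approximation_system) (g : nat -> C -> C),
    is_AS_for A g ->
    (forall i, lt_order i (as_order A) -> convex_set (as_V A i)) ->
  forall n : nat,
    le_order n (as_order A) ->
    proper_for_order A n ->
    ((forall i, (i < n)%nat -> is_finite (supnorm (as_Y A i) (D2 (as_f A i)))) ->
     is_finite (supnorm (as_U A) (fun x => g n x - g n (as_u A))%C) ->
     forall x, as_U A x ->
       Cmod (g 0%nat x - approx A n x)%C <=
       prod_below (fun i => real (supnorm (as_Y A i) (D2 (as_f A i)))) n
       * real (supnorm (as_U A) (fun y => g n y - g n (as_u A))%C)
       * (inner_dist (as_U A) (as_u A) x ^ n / INR (fact n)))
    /\
    (lt_order n (as_order A) ->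
     (forall i, (i < n)%nat -> is_finite (supnorm (as_Y A i) (D2 (as_f A i)))) ->
     is_finite (supnorm (setprod (as_U A) (image (g (S n)) (as_U A))) (as_f A n)) ->
     forall x, as_U A x ->
       Cmod (g 0%nat x - approx A n x)%C <=
       prod_below (fun i => real (supnorm (as_Y A i) (D2 (as_f A i)))) n
       * real (supnorm (setprod (as_U A) (image (g (S n)) (as_U A))) (as_f A n))
       * (inner_dist (as_U A) (as_u A) x ^ (S n) / INR (fact (S n)))).
Proof.
  intros A g HA Hconv n Hn HP.
  pose proof HA as (_ & HgV & Hgu & Hgd).
  split.
  - intros HfM HfN x Hx.
    (* Case [m = 0]: the initial bound is the constant [N], since the factor l^0/0! is 1. *)
    replace (inner_dist (as_U A) (as_u A) x ^ n / INR (fact n)) with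
      (inner_dist (as_U A) (as_u A) x ^ (n + 0) / INR (fact (n + 0)))
      by now rewrite Nat.add_0_r.
    apply approx_error_bound; try assumption. intros gamma (_ & HgU & _) t Ht.
    rewrite <- Hgu by exact Hn. simpl. unfold Rdiv. rewrite Rinv_1, !Rmult_1_r.
    apply (supnorm_bound (as_U A) (fun y => g n y - g n (as_u A))%C); auto.
  - intros Hlt HfM HfN x Hx.
    replace (inner_dist (as_U A) (as_u A) x ^ S n / INR (fact (S n))) with
      (inner_dist (as_U A) (as_u A) x ^ (n + 1) / INR (fact (n + 1)))
      by now rewrite Nat.add_1_r.
    apply approx_error_bound; try assumption. intros gamma Hg t Ht.
    pose proof Hg as (_ & HgU & _).
    (* Case [m = 1]: the initial bound is itself one integration step, with [k = 0], starting from
       the bound on the derivative of [g n]. *)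
    apply (growth_bound (as_U A) (as_u A) x (fun z => g n z - as_a A n)%C
      (fun z => as_f A n (z, g (S n) z)) gamma _ 0); try assumption.
    + intros z Hz. apply Cderiv_add_const, is_derive_Cderiv. now apply Hgd.
    + intros z Hz. apply (Cdiff_on_Ccont (as_U A)); [|exact Hz].
      apply as_f_comp_Cdiff; [exact Hlt | now apply AS_component_Cdiff | now apply HgV].
    + rewrite Hgu by exact Hn. ring.
    + intros s Hs. simpl. unfold Rdiv. rewrite Rinv_1, !Rmult_1_r.
      apply supnorm_bound; [exact HfN|]. split; [now apply HgU|].
      exists (gamma s). split; [now apply HgU | reflexivity].
Qed.
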